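(* Let $Y$ be a projective conifold over $\mathbb{C}$ with exactly one conifold singularity, arising as the fiber $W_0=Y$ over $\mathbf 0$ of a flat family $\pi:W\to\mathbb{A}^1$ of $3$-dimensional projective varieties with smooth total space $W$ and smooth fibers $W_t$ for $t\neq\mathbf 0$. Let $(Y_0,D)$ and $(Y_1,D)$ be the canonical smooth pairs associated to $Y$. Then the varieties obtained by gluing $(Y_0,D)$ and $(Y_1,D)$ along $D$ via an automorphism of $D$ are all isomorphic to each other: for any two automorphisms $f,f':D\to D$, the variety $Y_0\cup_{D,f}Y_1$ obtained by identifying $D\subset Y_0$ with $D\subset Y_1$ via $f$ is isomorphic to the variety $Y_0\cup_{D,f'}Y_1$.
   Context: All schemes are over $\mathbb{C}$. A conifold singularity is a point at which the family $\pi$ has the local analytic (formal) form $\operatorname{Spec}\mathbb{C}[[x,y,z,w]]\to\operatorname{Spec}\mathbb{C}[[t]]$, $t\mapsto xy-zw$, so that $Y=W_0$ is locally $\{xy-zw=0\}$ there. The canonical smooth pairs associated to $Y$ are the following. $Y_0=\widetilde Y$ is the blow-up of $Y$ at its conifold singularity; it is smooth, and $D\subset Y_0$ is the exceptional divisor, isomorphic to $\mathbb{P}^1\times\mathbb{P}^1$. $Y_1$ is the double cover of $\mathbb{P}^3$ branched over a smooth quadric surface, i.e. a smooth quadric hypersurface in $\mathbb{P}^4$, and $D\subset Y_1$ is a smooth hyperplane section, also isomorphic to $\mathbb{P}^1\times\mathbb{P}^1$; explicitly $Y_1=V(u^2+xy-zw)\subset\mathbb{P}^4$ and $D=V(u)\cap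 Y_1$ in homogeneous coordinates $[u:x:y:z:w]$. The two copies of $D$ are identified by a fixed isomorphism. The pairs arise as the components of the central fiber $Y_0\cup_D Y_1$ of the semi-stable reduction of $W/\mathbb{A}^1$ obtained by blowing up the conifold point of $W$, base changing by the degree-$2$ cover of $\mathbb{A}^1$ branched over $\mathbf 0$, and normalizing. *)

(* Defs.v *)
From HB Require Import structures.
From mathcomp Require Import all_boot all_order all_algebra.
From mathcomp Require Import generic_quotient complex.
From mathcomp Require Import all_classical reals.
From mathcomp Require Import topology_structure initial_topology.
From mathcomp Require Import sigT_topology subtype_topology quotient_topology.
From mathcomp Require Import mpoly.
From Stdlib Require Import Relation_Operators.

Set Implicit Arguments.
Unset Strict Implicit.
Unset Printing Implicit Defensive.

Import Order.TTheory GRing.Theory Num.Theory.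
Local Open Scope classical_set_scope.
Local Open Scope ring_scope.

(** Everything that occurs below is a reduced scheme of finite type over an
    algebraically closed field [K].  Such a scheme is encoded by the
    topological space of its closed points with its sheaf of [K]-valued regular
    functions.

    The sheaf is given by its germs: [regular_at x f] says that the function
    [f], whose values far from [x] are irrelevant, is regular in a neighbourhood
    of [x].  The sections over an open set [U] are the functions on [U] that are
    regular at every point of [U]; conversely, for a sheaf [F] of functions,
    [regular_at x f] means that [f] restricts to a section of [F] over some open
    neighbourhood of [x].  The two laws below are what makes this a bijection. *)
Record fspace (K : closedFieldType) := FSpace {
  fspace_sort :> topologicalType;
  regular_at : fspace_sort -> (fspace_sort -> K) -> Prop;
  regular_at_germ : forall x f g,
    (\forall y \near x, f y = g y) -> regular_at x f -> regular_at x g;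
  regular_at_open : forall x f,
    regular_at x f -> \forall y \near x, regular_at y f }.

Arguments regular_at {K f0} : rename.

Section Morphisms.
Context {K : closedFieldType}.
Implicit Types X Y : fspace K.

Definition is_morphism X Y (f : X -> Y) : Prop :=
  continuous f /\
  forall x (g : Y -> K), regular_at (f x) g -> regular_at x (g \o f).

Definition is_isomorphism X Y (f : X -> Y) : Prop :=
  is_morphism f /\
  exists g : Y -> X, [/\ is_morphism g, cancel f g & cancel g f].

Definition isomorphic X Y : Prop := exists f : X -> Y, is_isomorphism f.

End Morphisms.

(** The structure induced on a subset: restriction of the sheaf if [A] is open,
    reduced induced structure if [A] is closed. *)
Section Subspace.
Context {K : closedFieldType} {X : fspace K} (A : set X).

Definition sub_regular_at (x : set_type A) (f : set_type A -> K) : Prop :=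
  exists2 g : X -> K, regular_at (val x) g &
    \forall y \near x, f y = g (val y).

Lemma sub_regular_at_germ x f g :
  (\forall y \near x, f y = g y) -> sub_regular_at x f -> sub_regular_at x g.
Proof.
move=> fg [h hreg fh]; exists h => //.
by apply: filterS2 fg fh => y <-.
Qed.

Lemma sub_regular_at_open x f :
  sub_regular_at x f -> \forall y \near x, sub_regular_at y f.
Proof.
move=> [g greg fg].
have gval : \forall y \near x, regular_at (val y) g.
  exact: (@initial_continuous _ _ (set_val : set_type A -> X) x _
            (regular_at_open greg)).
have fg2 := nbhs_interior fg.
by apply: filterS2 gval fg2 => y gy fgy; exists g.
Qed.

Definition subspace_of : fspace K :=
  FSpace sub_regular_at_germ sub_regular_at_open.

End Subspace.

Section AffineSpace.
Context {K : closedFieldType} {n : nat}.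

Definition affine_pt : Type := 'rV[K]_n.
HB.instance Definition _ := Choice.on affine_pt.

Definition aeval (f : {mpoly K[n]}) (a : affine_pt) : K := f.@[(a : 'rV_n) 0].

Definition azeros (S : set {mpoly K[n]}) : set affine_pt :=
  [set a | forall f, S f -> aeval f a = 0].

Definition azariski : set (set affine_pt) :=
  [set U | exists S, U = ~` azeros S].

Lemma azariskiT : azariski setT.
Proof.
exists setT; apply/esym/seteqP; split=> // a _ /(_ 1 I).
by rewrite /aeval meval1 => /eqP; rewrite oner_eq0.
Qed.

Lemma azariskiI : setI_closed azariski.
Proof.
move=> _ _ [S ->] [T ->].
exists [set h | exists f g, [/\ S f, T g & h = f * g]].
rewrite -setCU; congr (~` _); apply/seteqP; split=> a.
  move=> az _ [f [g [Sf Tg ->]]]; rewrite /aeval mevalM.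
  case: az => [/(_ f Sf)|/(_ g Tg)]; rewrite /aeval => ->.
    by rewrite mul0r.
  by rewrite mulr0.
move=> h0; apply: contrapT => /not_orP[].
move=> /existsNP[f /not_implyP[Sf /eqP fa]].
move=> /existsNP[g /not_implyP[Tg /eqP ga]].
have /eqP := h0 (f * g) (ex_intro _ f (ex_intro _ g (And3 Sf Tg erefl))).
by rewrite /aeval mevalM mulf_eq0 (negPf fa) (negPf ga).
Qed.

Lemma azariski_bigU (I : Type) (f : I -> set affine_pt) :
  (forall i, azariski (f i)) -> azariski (\bigcup_i f i).
Proof.
move=> /choice[S fS]; exists (\bigcup_i S i).
rewrite (eq_bigcupr (fun i _ => fS i)) -setC_bigcap; congr (~` _).
apply/seteqP; split=> a.
  by move=> h p [i _ Sp]; exact: h Sp.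
by move=> h i _ p Sp; apply: h; exists i.
Qed.

HB.instance Definition _ :=
  isOpenTopological.Build affine_pt azariskiT azariskiI azariski_bigU.

Lemma aeval_neq0_open (f : {mpoly K[n]}) : open [set a | aeval f a != 0].
Proof.
exists [set f]; apply/seteqP; split=> a /=.
  by move=> /eqP fa /(_ f erefl).
by move=> h; apply/eqP => fa; apply: h => _ ->.
Qed.

Definition aregular_at (a : affine_pt) (f : affine_pt -> K) : Prop :=
  exists P Q : {mpoly K[n]},
    aeval Q a != 0 /\ \forall b \near a, f b = aeval P b / aeval Q b.

Lemma aregular_at_germ a f g :
  (\forall b \near a, f b = g b) -> aregular_at a f -> aregular_at a g.
Proof.
move=> fg [P [Q [Qa fPQ]]]; exists P, Q; split=> //.
by apply: filterS2 fg fPQ => b <-.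
Qed.

Lemma aregular_at_open a f :
  aregular_at a f -> \forall b \near a, aregular_at b f.
Proof.
move=> [P [Q [Qa fPQ]]].
have Qn : \forall b \near a, aeval Q b != 0.
  by apply: open_nbhs_nbhs; split => //; exact: aeval_neq0_open.
have fPQ2 := nbhs_interior fPQ.
by apply: filterS2 Qn fPQ2 => b Qb fb; exists P, Q.
Qed.

Definition affine_space : fspace K := FSpace aregular_at_germ aregular_at_open.

End AffineSpace.

Arguments affine_pt : clear implicits.
Arguments affine_space : clear implicits.

Section ProjectiveSpace.
Context {K : closedFieldType} {n : nat}.

Definition proj_pt : Type := {L : {vspace 'rV[K]_n.+1} | \dim L == 1%N}.
HB.instance Definition _ := Choice.on proj_pt.

(** [peval f L] is the value of [f] at one chosen nonzero vector of the line
    [L].  It is only used for the vanishing of a homogeneous polynomial and for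
    quotients of two homogeneous polynomials of the same degree; neither
    depends on the choice. *)
Definition peval (f : {mpoly K[n.+1]}) (L : proj_pt) : K :=
  f.@[vpick (val L) 0].

Definition homogeneous (f : {mpoly K[n.+1]}) : Prop :=
  exists d : nat, f \is d.-homog.

Definition pzeros (S : set {mpoly K[n.+1]}) : set proj_pt :=
  [set L | forall f, S f -> peval f L = 0].

Definition pzariski : set (set proj_pt) :=
  [set U | exists2 S, S `<=` homogeneous & U = ~` pzeros S].

Lemma pzariskiT : pzariski setT.
Proof.
exists [set 1]; first by move=> _ ->; exists 0%N; exact: dhomog1.
apply/esym/seteqP; split=> // a _ /(_ 1 erefl).
by rewrite /peval meval1 => /eqP; rewrite oner_eq0.
Qed.

Lemma pzariskiI : setI_closed pzariski.
Proof.
move=> _ _ [S Sh ->] [T Th ->].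
exists [set h | exists f g, [/\ S f, T g & h = f * g]].
  move=> _ [f [g [/Sh[d fd] /Th[e ge] ->]]].
  by exists (d + e)%N; exact: dhomogM.
rewrite -setCU; congr (~` _); apply/seteqP; split=> a.
  move=> az _ [f [g [Sf Tg ->]]]; rewrite /peval mevalM.
  case: az => [/(_ f Sf)|/(_ g Tg)]; rewrite /peval => ->.
    by rewrite mul0r.
  by rewrite mulr0.
move=> h0; apply: contrapT => /not_orP[].
move=> /existsNP[f /not_implyP[Sf /eqP fa]].
move=> /existsNP[g /not_implyP[Tg /eqP ga]].
have /eqP := h0 (f * g) (ex_intro _ f (ex_intro _ g (And3 Sf Tg erefl))).
by rewrite /peval mevalM mulf_eq0 (negPf fa) (negPf ga).
Qed.

Lemma pzariski_bigU (I : Type) (f : I -> set proj_pt) :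
  (forall i, pzariski (f i)) -> pzariski (\bigcup_i f i).
Proof.
move=> fz; have /choice[S fS] : forall i, exists S : set {mpoly K[n.+1]},
    S `<=` homogeneous /\ f i = ~` pzeros S.
  by move=> i; have [S] := fz i; exists S.
exists (\bigcup_i S i); first by move=> p [i _ /(proj1 (fS i))].
rewrite (eq_bigcupr (fun i _ => proj2 (fS i))) -setC_bigcap; congr (~` _).
apply/seteqP; split=> a.
  by move=> h p [i _ Sp]; exact: h Sp.
by move=> h i _ p Sp; apply: h; exists i.
Qed.

HB.instance Definition _ :=
  isOpenTopological.Build proj_pt pzariskiT pzariskiI pzariski_bigU.

Lemma peval_neq0_open (f : {mpoly K[n.+1]}) :
  homogeneous f -> open [set L | peval f L != 0].
Proof.
move=> fh; exists [set f]; first by move=> _ ->.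
apply/seteqP; split=> a /=.
  by move=> /eqP fa /(_ f erefl).
by move=> h; apply/eqP => fa; apply: h => _ ->.
Qed.

Definition pregular_at (L : proj_pt) (f : proj_pt -> K) : Prop :=
  exists d (P Q : {mpoly K[n.+1]}),
    [/\ P \is d.-homog, Q \is d.-homog, peval Q L != 0
      & \forall M \near L, f M = peval P M / peval Q M].

Lemma pregular_at_germ L f g :
  (\forall M \near L, f M = g M) -> pregular_at L f -> pregular_at L g.
Proof.
move=> fg [d [P [Q [Pd Qd QL fPQ]]]]; exists d, P, Q; split=> //.
by apply: filterS2 fg fPQ => b <-.
Qed.

Lemma pregular_at_open L f :
  pregular_at L f -> \forall M \near L, pregular_at M f.
Proof.
move=> [d [P [Q [Pd Qd QL fPQ]]]].
have Qn : \forall M \near L, peval Q M != 0.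
  apply: open_nbhs_nbhs; split => //.
  by apply: peval_neq0_open; exists d.
have fPQ2 := nbhs_interior fPQ.
by apply: filterS2 Qn fPQ2 => M QM fM; exists d, P, Q.
Qed.

Definition proj_space : fspace K := FSpace pregular_at_germ pregular_at_open.

End ProjectiveSpace.

Arguments proj_pt : clear implicits.
Arguments proj_space : clear implicits.

Section Varieties.
Context {K : closedFieldType}.
Implicit Types X Y : fspace K.

Definition affine_fspace X : Prop :=
  exists n (Z : set (affine_space K n)),
    closed Z /\ isomorphic X (subspace_of Z).

Definition affine_open X (U : set X) : Prop :=
  open U /\ affine_fspace (subspace_of U).

Definition separated_fspace X : Prop :=
  forall (T : fspace K) (f g : T -> X), affine_fspace T ->
    is_morphism f -> is_morphism g -> closed [set t | f t = g t].

(** Reduced, separated and of finite type, not necessarily irreducible. *)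
Definition variety X : Prop :=
  (exists k (U : 'I_k -> set X),
     (forall i, affine_open (U i)) /\ \bigcup_i U i = setT) /\
  separated_fspace X.

Definition irreducible_set (T : topologicalType) (A : set T) : Prop :=
  A !=set0 /\ forall F G : set T, closed F -> closed G ->
    A `<=` F `|` G -> A `<=` F \/ A `<=` G.

Definition irreducible_chain (T : topologicalType) n (c : nat -> set T) : Prop :=
  (forall i, (i <= n)%N -> closed (c i) /\ irreducible_set (c i)) /\
  forall i, (i < n)%N -> c i `<` c i.+1.

Definition has_dimension (T : topologicalType) (n : nat) : Prop :=
  (exists c : nat -> set T, irreducible_chain n c) /\
  ~ exists c : nat -> set T, irreducible_chain n.+1 c.

Definition projective_variety X : Prop :=
  irreducible_set [set: X] /\
  exists n (Z : set (proj_space K n)),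
    closed Z /\ isomorphic X (subspace_of Z).

(** Near [x], [X] is the common zero locus of [c] polynomials whose Jacobian
    matrix has rank [c].  By the Jacobian criterion the scheme they define is
    then reduced near the image of [x]. *)
Definition smooth_at X (x : X) : Prop :=
  exists n c (f : 'I_c -> {mpoly K[n]}) (U : set X) (V : set (affine_space K n)),
  exists phi : subspace_of U -> subspace_of (V `&` azeros (range f)),
    [/\ open U, open V, is_isomorphism phi &
      exists2 u : subspace_of U, val u = x &
        \rank (\matrix_(i < c, j < n) aeval (mderiv j (f i)) (val (phi u))) = c].

Definition smooth X : Prop := forall x : X, smooth_at x.

End Varieties.

Section Flatness.
Context {A : comNzRingType}.

(** [\sum_i x i (x) m i = 0] in the tensor product of [N] and [M], by the
    universal property of the tensor product. *)
Definition tensor_null (N M : lmodType A) k (x : 'I_k -> N) (m : 'I_k -> M) :=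
  forall (P : lmodType A) (beta : N -> M -> P),
    (forall n, linear (beta n)) -> (forall m', linear (beta^~ m')) ->
    \sum_i beta (x i) (m i) = 0.

Definition flat_module (M : lmodType A) : Prop :=
  forall (N' N : lmodType A) (phi : {linear N' -> N}), injective phi ->
  forall k (x : 'I_k -> N') (m : 'I_k -> M),
    tensor_null (phi \o x) m -> tensor_null x m.

End Flatness.

Section Families.
Context {K : closedFieldType}.

Definition line_coord (t : affine_space K 1) : K := (t : 'rV_1) 0 0.

Definition line_pt (c : K) : affine_space K 1 := const_mx c.

Section Family.
Variables (W : fspace K) (pi : W -> affine_space K 1).

Definition fibre (t : affine_space K 1) : set W := [set w | pi w = t].

(** [M] is the [K[t]]-module of regular functions on [U], where [t] acts as
    multiplication by [pi]; [ev] is the inclusion into functions (a function on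
    [U] is represented by any of its extensions to [W]). *)
Definition sections_module (U : set W) (M : lmodType {poly K})
    (ev : M -> W -> K) : Prop :=
  [/\ (forall (p : {poly K}) m m' w, U w ->
         ev (p *: m + m') w = p.[line_coord (pi w)] * ev m w + ev m' w),
      (forall m w, U w -> regular_at w (ev m)),
      (forall m m', (forall w, U w -> ev m w = ev m' w) -> m = m') &
      (forall f, (forall w, U w -> regular_at w f) ->
         exists m, forall w, U w -> ev m w = f w)].

Definition flat_over_line : Prop :=
  forall U : set W, affine_open U ->
  exists (M : lmodType {poly K}) (ev : M -> W -> K),
    sections_module U ev /\ flat_module M.

(** The scheme-theoretic fibre over [t] is reduced: a function that vanishes
    on the set [fibre t] is locally a multiple of [pi - t].  Then [fibre t] with
    its reduced induced structure is the scheme-theoretic fibre. *)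
Definition reduced_fibre (t : affine_space K 1) : Prop :=
  forall w g, fibre t w -> regular_at w g ->
    (\forall v \near w, fibre t v -> g v = 0) ->
  exists2 h, regular_at w h &
    \forall v \near w, g v = h v * (line_coord (pi v) - line_coord t).

End Family.
End Families.

(** Formal power series in [n] variables, as families of coefficients. *)
Definition fps (K : closedFieldType) (n : nat) : Type := 'X_{1..n} -> K.

Section Conifold.
Context {K : closedFieldType}.

Definition fps_mul n (s t : fps K n) : fps K n := fun m =>
  \sum_(k : 'X_{1..n < (mdeg m).+1} | (bmnm k <= m)%MM) s k * t (m - k)%MM.

Definition fps_of_mpoly n (p : {mpoly K[n]}) : fps K n := fun m => p@_m.

(** The germ of [g] at [w] is in the [n]-th power of the maximal ideal. *)
Definition max_ideal_pow (W : fspace K) (w : W) (n : nat) (g : W -> K) : Prop :=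
  exists k (c : 'I_k -> W -> K) (a : 'I_k -> 'I_n -> W -> K),
    [/\ forall i, regular_at w (c i),
        forall i j, regular_at w (a i j) /\ a i j w = 0 &
        \forall v \near w, g v = \sum_i c i v * \prod_j a i j v].

(** [tau] is a homomorphism of [K]-algebras from the local ring of [W] at [w] to
    [K[[x_1,...,x_n]]] that exhibits the latter as the completion of the former:
    modulo the [d]-th powers of the maximal ideals it is bijective, for
    every [d].  The values of [tau] on functions that are not regular at [w]
    are irrelevant. *)
Definition formal_coordinates (W : fspace K) (w : W) (n : nat)
    (tau : (W -> K) -> fps K n) : Prop :=
  [/\ forall g h, regular_at w g -> (\forall v \near w, g v = h v) ->
        tau g = tau h,
      forall c, tau (cst c) = fps_of_mpoly c%:MP,
      forall g h, regular_at w g -> regular_at w h ->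
        (tau (fun v => g v + h v) = (fun m => tau g m + tau h m)) /\
        (tau (fun v => g v * h v) = fps_mul (tau g) (tau h)),
      forall d g, regular_at w g ->
        (max_ideal_pow w d g <-> forall m, (mdeg m < d)%N -> tau g m = 0) &
      forall d (s : fps K n), exists2 g, regular_at w g &
        forall m, (mdeg m < d)%N -> tau g m = s m].

(** In suitable formal coordinates [x, y, z, w] of [W] at [p], the function
    [pi] is [x y - z w]. *)
Definition conifold_singularity (W : fspace K) (pi : W -> affine_space K 1)
    (p : W) : Prop :=
  exists tau : (W -> K) -> fps K 4, formal_coordinates p tau /\
    tau (line_coord \o pi) =
      fps_of_mpoly ('X_(inord 0) * 'X_(inord 1) - 'X_(inord 2) * 'X_(inord 3)).

End Conifold.

Section BlowUp.
Context {K : closedFieldType}.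

(** The stalk at [y] of the ideal sheaf of the reduced point [p]. *)
Definition point_ideal (Y : fspace K) (p y : Y) (g : Y -> K) : Prop :=
  regular_at y g /\ (y = p -> g p = 0).

(** The inverse image ideal sheaf of the point [p] under [f] is generated at [t]
    by one element that is not a zero divisor. *)
Definition invertible_pullback_at (T Y : fspace K) (p : Y) (f : T -> Y) (t : T) :
    Prop :=
  exists e : T -> K,
  [/\ regular_at t e,
      forall a, regular_at t a -> (\forall s \near t, a s * e s = 0) ->
        \forall s \near t, a s = 0,
      forall g, point_ideal p (f t) g -> exists2 a, regular_at t a &
        \forall s \near t, g (f s) = a s * e s &
      exists k (a : 'I_k -> T -> K) (g : 'I_k -> Y -> K),
        [/\ forall i, regular_at t (a i), forall i, point_ideal p (f t) (g i) &
            \forall s \near t, e s = \sum_i a i s * g i (f s)]].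

Definition invertible_pullback (T Y : fspace K) (p : Y) (f : T -> Y) : Prop :=
  forall t, invertible_pullback_at p f t.

(** The blow-up of a variety is a variety, so it is determined by its universal
    property among varieties. *)
Definition is_blowup (Y : fspace K) (p : Y) (B : fspace K) (b : B -> Y) : Prop :=
  [/\ variety B, is_morphism b, invertible_pullback p b &
    forall (T : fspace K) (f : T -> Y), variety T -> is_morphism f ->
      invertible_pullback p f ->
    exists g : T -> B, [/\ is_morphism g, b \o g = f &
      forall g', is_morphism g' -> b \o g' = f -> g' = g]].

End BlowUp.

Section Quadric.
Context {K : closedFieldType}.

(** The homogeneous coordinates of [P^4] are [u, x, y, z, w], in this order. *)
Definition quadric_form : {mpoly K[5]} :=
  'X_(inord 0) ^+ 2 + 'X_(inord 1) * 'X_(inord 2) - 'X_(inord 3) * 'X_(inord 4).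

Definition quadric_threefold : fspace K :=
  subspace_of (pzeros [set quadric_form] : set (proj_space K 4)).

Definition quadric_section : set quadric_threefold :=
  [set y | peval 'X_(inord 0) (val y) = 0].

End Quadric.

Arguments quadric_threefold : clear implicits.
Arguments quadric_section : clear implicits.

(** [gluing h] is the union of [X0] and [X1] with [a] in [A0] identified with [h a]
    in [A1]: the quotient topological space of the disjoint union, with the
    functions on it whose restrictions to [X0] and [X1] are regular. *)
Section Glue.
Context {K : closedFieldType} {X0 X1 : fspace K} {A0 : set X0} {A1 : set X1}.
Variable h : subspace_of A0 -> subspace_of A1.

Definition glue_piece (b : bool) : topologicalType :=
  if b then X1 : topologicalType else X0 : topologicalType.

Definition glue_union : topologicalType := {b : bool & glue_piece b}.

Definition glue_inl (x : X0) : glue_union := existT glue_piece false x.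
Definition glue_inr (x : X1) : glue_union := existT glue_piece true x.

Definition glue_step (p q : glue_union) : Prop :=
  exists a, p = glue_inl (val a) /\ q = glue_inr (val (h a)).

Definition glue_rel (p q : glue_union) : bool :=
  `[< clos_refl_sym_trans glue_union glue_step p q >].

Lemma glue_rel_refl : reflexive glue_rel.
Proof. by move=> p; apply/asboolP; exact: rst_refl. Qed.

Lemma glue_rel_sym : ssrbool.symmetric glue_rel.
Proof.
by move=> p q; apply/asboolP/asboolP; exact: rst_sym.
Qed.

Lemma glue_rel_trans : transitive glue_rel.
Proof.
by move=> q p r /asboolP pq /asboolP qr; apply/asboolP; exact: rst_trans pq qr.
Qed.

Canonical glue_equiv := EquivRel glue_rel glue_rel_refl glue_rel_sym glue_rel_trans.

Definition glue_pt : topologicalType :=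
  quotient_topology {eq_quot glue_equiv}%qT.

Definition glue_pi (p : glue_union) : glue_pt :=
  (\pi_(quotient_topology {eq_quot glue_equiv}%qT) p)%qT.

Definition glue_in0 (x : X0) : glue_pt := glue_pi (glue_inl x).
Definition glue_in1 (x : X1) : glue_pt := glue_pi (glue_inr x).

Definition glue_regular_at (p : glue_pt) (f : glue_pt -> K) : Prop :=
  \forall q \near p,
    (forall x, glue_in0 x = q -> regular_at x (f \o glue_in0)) /\
    (forall x, glue_in1 x = q -> regular_at x (f \o glue_in1)).

Lemma glue_regular_at_open p f :
  glue_regular_at p f -> \forall q \near p, glue_regular_at q f.
Proof. exact: nbhs_interior. Qed.

Lemma glue_in0_continuous : continuous glue_in0.
Proof.
move=> x; apply: (@continuous_comp X0 glue_union glue_pt glue_inl glue_pi).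
  exact: (@existT_continuous bool glue_piece false).
exact: pi_continuous.
Qed.

Lemma glue_in1_continuous : continuous glue_in1.
Proof.
move=> x; apply: (@continuous_comp X1 glue_union glue_pt glue_inr glue_pi).
  exact: (@existT_continuous bool glue_piece true).
exact: pi_continuous.
Qed.

Lemma glue_regular_at_germ p f g :
  (\forall q \near p, f q = g q) -> glue_regular_at p f -> glue_regular_at p g.
Proof.
move=> /nbhs_interior fg; apply: filterS2 fg => q fgq [f0 f1].
split=> x xq.
  have fgx : \forall y \near x, f (glue_in0 y) = g (glue_in0 y).
    by apply: (@glue_in0_continuous x [set q | f q = g q]); rewrite xq.
  exact: regular_at_germ fgx (f0 x xq).
have fgx : \forall y \near x, f (glue_in1 y) = g (glue_in1 y).
  by apply: (@glue_in1_continuous x [set q | f q = g q]); rewrite xq.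
exact: regular_at_germ fgx (f1 x xq).
Qed.

Definition gluing : fspace K :=
  FSpace glue_regular_at_germ glue_regular_at_open.

End Glue.

(* Main.v *)
From mathcomp Require Import all_boot all_order all_algebra.
From mathcomp Require Import generic_quotient complex.
From mathcomp Require Import all_classical reals.
From mathcomp Require Import topology_structure initial_topology.
From mathcomp Require Import sigT_topology subtype_topology quotient_topology.
From mathcomp Require Import mpoly perm ring.
Require Import Defs.
From Stdlib Require Import Relation_Operators.

(** It suffices to extend every automorphism of the quadric surface [D] to
    the quadric threefold [Y_1]: the extension of [phi f' f^-1 phi^-1], glued
    with the identity of [Y_0], is then the required isomorphism.

    Write [D] as [P^1 x P^1] and let [g] be an automorphism.  It maps the
    disjoint lines of a ruling to disjoint curves, parametrized with bidegrees
    [(d1, d2)] and [(e1, e2)] say.  Were the intersection number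
    [d1 e2 + d2 e1] positive, then the resultant of the two
    parametrizations would be a form of positive degree and have a zero,
    which is an intersection point.  So [g] maps rulings to rulings, and is
    the product of two automorphisms of [P^1], possibly composed with the
    exchange of the factors.  Automorphisms of [P^1] are linear, so that [g] is
    induced by [N |-> P N Q^T] or [N |-> Q N^T P^T] on 2x2 matrices [N]; after
    rescaling this preserves [det N = x y - z w], and fixing the coordinate [u]
    extends it to the quadric [u^2 + x y - z w = 0]. *)

Set Implicit Arguments.
Unset Strict Implicit.
Unset Printing Implicit Defensive.

Import Order.TTheory GRing.Theory.
Local Open Scope ring_scope.

(** * Binary forms *)

Section BinaryForms.
Variable K : closedFieldType.
Implicit Types (p q : {poly K}) (v w : K * K) (f g : K * K -> K).

Lemma size_mul_le k l p q : (size p <= k)%N -> (size q <= l.+1)%N ->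
  (size (p * q)%R <= k + l)%N.
Proof.
move=> pk ql; apply: leq_trans (size_polyMleq _ _) _.
by rewrite -subn1 leq_subLR add1n -addnS leq_add.
Qed.

(** The homogenization of [p] to formal degree [d], evaluated at [v]; coefficients of [p] beyond [d]
    are dropped. *)
Definition hev d p v : K := \sum_(i < d.+1) p`_i * v.1 ^+ i * v.2 ^+ (d - i).

Lemma hev_affine d p v : (size p <= d.+1)%N -> v.2 != 0 ->
  hev d p v = v.2 ^+ d * p.[v.1 / v.2].
Proof.
move=> sp v2; rewrite (horner_coef_wide _ sp) mulr_sumr; apply: eq_bigr => i _.
have id : (i <= d)%N by rewrite -ltnS ltn_ord.
rewrite expr_div_n; have -> : v.2 ^+ d = v.2 ^+ (d - i) * v.2 ^+ i.
  by rewrite -exprD subnK.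
by field; rewrite expf_neq0.
Qed.

Lemma hev_infinity d p v : v.2 = 0 -> hev d p v = p`_d * v.1 ^+ d.
Proof.
move=> v2; rewrite /hev big_ord_recr /= subnn expr0 mulr1 big1 ?add0r // => i _.
by rewrite v2 expr0n subn_eq0 leqNgt ltn_ord mulr0.
Qed.

Lemma hevM d e p q v : (size p <= d.+1)%N -> (size q <= e.+1)%N ->
  hev (d + e) (p * q) v = hev d p v * hev e q v.
Proof.
move=> sp sq.
have spq : (size (p * q)%R <= (d + e).+1)%N by exact: (@size_mul_le d.+1).
have [v2|v2] := eqVneq v.2 0; last first.
  by rewrite !hev_affine // hornerM exprD; ring.
rewrite !hev_infinity // exprD.
(* By the size bounds only the product of the top coefficients, at the formal degrees [d] and [e],
   contributes. *)
suff -> : (p * q)`_(d + e) = p`_d * q`_e by ring.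
have dlt : (d < (d + e).+1)%N by rewrite ltnS leq_addr.
rewrite coefM (bigD1 (Ordinal dlt)) //= addKn big1 ?addr0 // => i nid.
have [id|di] := ltnP i d.
  rewrite (@nth_default _ _ q) ?mulr0 //; apply: leq_trans sq _.
  by rewrite -(@addnBAC d i e (ltnW id)) -add1n leq_add2r subn_gt0.
rewrite (@nth_default _ _ p) ?mul0r //; apply: leq_trans sp _.
by rewrite ltn_neqAle di andbT eq_sym -val_eqE in nid *.
Qed.

(** A binary form is recorded through its values, so that it can be recognized in determinants and
    compositions; the zero function is a form of every degree. *)
Definition isform d f : Prop :=
  exists2 p : {poly K}, (size p <= d.+1)%N & forall v, f v = hev d p v.

Lemma isform_ext d f g : f =1 g -> isform d f -> isform d g.
Proof. by move=> fg [p sp fp]; exists p => // v; rewrite -fg. Qed.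

Lemma isform_hev d p : (size p <= d.+1)%N -> isform d (hev d p).
Proof. by exists p. Qed.

Lemma isformC c : isform 0 (fun=> c).
Proof.
exists c%:P; first exact: leq_trans (size_polyC_leq1 _) _.
by move=> v; rewrite /hev big_ord1 coefC /= !expr0 !mulr1.
Qed.

Lemma isform0 d : isform d (fun=> 0).
Proof.
exists 0; first by rewrite size_poly0.
by move=> v; rewrite /hev big1 // => i _; rewrite coef0 !mul0r.
Qed.

Lemma isform_fst : isform 1 fst.
Proof.
exists 'X; first by rewrite size_polyX.
by move=> v; rewrite /hev !big_ord_recr big_ord0 /= !coefX /=; ring.
Qed.

Lemma isform_snd : isform 1 snd.
Proof.
exists 1; first by rewrite size_poly1.
by move=> v; rewrite /hev !big_ord_recr big_ord0 /= !coef1 /=; ring.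
Qed.

Lemma isformD d f g : isform d f -> isform d g -> isform d (fun v => f v + g v).
Proof.
move=> [p sp fp] [q sq gq]; exists (p + q).
  by apply: leq_trans (size_polyD _ _) _; rewrite geq_max sp.
move=> v; rewrite fp gq /hev -big_split; apply: eq_bigr => i _ /=.
by rewrite coefD; ring.
Qed.

Lemma isformM d e f g :
  isform d f -> isform e g -> isform (d + e) (fun v => f v * g v).
Proof.
move=> [p sp fp] [q sq gq]; exists (p * q); last by move=> v; rewrite fp gq hevM.
exact: (@size_mul_le d.+1).
Qed.

Lemma isformZ d c f : isform d f -> isform d (fun v => c * f v).
Proof. exact: (isformM (isformC c)). Qed.

Lemma isformB d f g : isform d f -> isform d g -> isform d (fun v => f v - g v).
Proof.
move=> hf hg; apply: (@isform_ext _ (fun v => f v + (-1) * g v)).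
  by move=> v; ring.
exact: isformD hf (isformZ _ hg).
Qed.

Lemma isformX d k f : isform d f -> isform (d * k) (fun v => f v ^+ k).
Proof.
move=> hf; elim: k => [|k IH]; first by rewrite muln0; exact: isformC.
rewrite mulnS; apply: isform_ext (isformM hf IH) => v.
by rewrite exprS.
Qed.

Lemma isform_sum d (I : Type) (r : seq I) (P : pred I) (F : I -> K * K -> K) :
  (forall i, P i -> isform d (F i)) ->
  isform d (fun v => \sum_(i <- r | P i) F i v).
Proof.
move=> hF; elim: r => [|i r IH].
  by apply: isform_ext (isform0 d) => v; rewrite big_nil.
case Pi: (P i); last by apply: isform_ext IH => v; rewrite big_cons Pi.
apply: isform_ext (isformD (hF i Pi) IH) => v.
by rewrite big_cons Pi.
Qed.

Lemma isform_prod (I : Type) (d : I -> nat) (r : seq I) (F : I -> K * K -> K) :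
  (forall i, isform (d i) (F i)) ->
  isform (\sum_(i <- r) d i) (fun v => \prod_(i <- r) F i v).
Proof.
move=> hF; elim: r => [|i r IH].
  by rewrite big_nil; apply: isform_ext (isformC 1) => v; rewrite big_nil.
rewrite big_cons; apply: isform_ext (isformM (hF i) IH) => v.
by rewrite big_cons.
Qed.

(** Every term of the Leibniz expansion takes one entry from each row, so the degrees of the rows
    add up. *)
Lemma isform_det n (d : 'I_n -> nat) (M : K * K -> 'M[K]_n) :
  (forall i j, isform (d i) (fun v => M v i j)) ->
  isform (\sum_i d i) (fun v => \det (M v)).
Proof.
move=> hM; apply: isform_sum => s _; apply: isformZ.
exact: (@isform_prod _ d _ (fun i v => M v i (s i)) (fun i => hM i (s i))).
Qed.

Lemma isform_comp d e f g1 g2 : isform d f -> isform e g1 -> isform e g2 ->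
  isform (e * d) (fun v => f (g1 v, g2 v)).
Proof.
move=> [p sp fp] h1 h2.
apply: (@isform_ext _ (fun v =>
  \sum_(i < d.+1) p`_i * (g1 v ^+ i * g2 v ^+ (d - i)))).
  by move=> v; rewrite fp; apply: eq_bigr => i _; rewrite mulrA.
apply: isform_sum => i _; apply: isformZ.
have -> : (e * d = e * i + e * (d - i))%N.
  by rewrite -mulnDr subnKC // -ltnS.
exact: isformM (isformX i h1) (isformX (d - i) h2).
Qed.

Lemma hev_scale d p c v : hev d p (c * v.1, c * v.2) = c ^+ d * hev d p v.
Proof.
rewrite /hev mulr_sumr; apply: eq_bigr => i _ /=.
have id : (i <= d)%N by rewrite -ltnS ltn_ord.
have -> : c ^+ d = c ^+ (d - i) * c ^+ i by rewrite -exprD subnK.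
by rewrite !exprMn; ring.
Qed.

Lemma isform_scale d f c v : isform d f -> f (c * v.1, c * v.2) = c ^+ d * f v.
Proof. by move=> [p _ fp]; rewrite !fp hev_scale. Qed.

Lemma isform_deg0 f v w : isform 0 f -> f v = f w.
Proof. by move=> [p _ fp]; rewrite !fp /hev !big_ord1 /= !expr0 !mulr1. Qed.

Lemma pair_neq0 v : (v != 0) = (v.1 != 0) || (v.2 != 0).
Proof. by case: v => a b; rewrite -negb_and. Qed.

Lemma point_neq0 (x : K) : (x, 1) != 0 :> K * K.
Proof. by rewrite pair_neq0 /= oner_eq0 orbT. Qed.

Lemma infinity_neq0 : (1, 0) != 0 :> K * K.
Proof. by rewrite pair_neq0 /= oner_eq0. Qed.

(** A root of the dehomogenization gives a zero [(x, 1)]. Only a nonzero constant has no root; the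
    form is then a multiple of [v.2 ^+ d], which vanishes at infinity because [d] is positive. *)
Lemma isform_root d f : (0 < d)%N -> isform d f -> exists2 v, v != 0 & f v = 0.
Proof.
move=> d0 [p sp fp].
have [/closed_rootP[x px]|] := boolP (size p != 1).
  exists (x, 1); first exact: point_neq0.
  by rewrite fp hev_affine //= ?oner_eq0 // divr1 (rootP px) mulr0.
rewrite negbK => /eqP s1; exists (1, 0); first exact: infinity_neq0.
by rewrite fp hev_infinity // nth_default ?mul0r // s1.
Qed.

Lemma isform_nonzero d e f g : isform d f -> isform e g ->
  (exists v, f v != 0) -> (exists v, g v != 0) ->
  exists2 v, v != 0 & f v * g v != 0.
Proof.
have poly_neq0 n (h : K * K -> K) p : (forall v, h v = hev n p v) ->
    (exists v, h v != 0) -> p != 0.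
  move=> hp [v hv]; apply: contraNneq hv => p0; rewrite hp p0 /hev big1 // => i _.
  by rewrite coef0 !mul0r.
move=> [p sp fp] [q sq gq] /(poly_neq0 _ _ _ fp) pn /(poly_neq0 _ _ _ gq) qn.
have /closed_nonrootP[x] : p * q != 0 by rewrite mulf_neq0.
rewrite /root hornerM => pqx; exists (x, 1); first exact: point_neq0.
by rewrite fp gq !hev_affine //= ?oner_eq0 // divr1 !expr1n !mul1r.
Qed.

(** Density of a nonempty open set: if [f] were nonzero somewhere, the product of two nonzero
    polynomials would have a nonroot, where neither form vanishes. *)
Lemma isform_cancel d e f g : isform d f -> isform e g ->
  (exists v, g v != 0) -> (forall v, v != 0 -> g v != 0 -> f v = 0) ->
  forall v, f v = 0.
Proof.
move=> hf hg gn fg v; apply/eqP; apply: contraT => fv.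
have [w wn] := isform_nonzero hf hg (ex_intro _ v fv) gn.
by rewrite mulf_eq0 negb_or => /andP[fw /(fg _ wn) fw0]; rewrite fw0 eqxx in fw.
Qed.

(** For a finite zero this is the factor theorem for the dehomogenization. For a zero at infinity
    the top coefficient vanishes, so that [w.2] splits off. *)
Lemma isform_divl d f v : v != 0 -> isform d.+1 f -> f v = 0 ->
  exists2 g, isform d g & forall w, f w = (w.1 * v.2 - w.2 * v.1) * g w.
Proof.
move=> vn [p sp fp] fv; have [v2|v2] := eqVneq v.2 0.
  have v1 : v.1 != 0 by move: vn; rewrite pair_neq0 v2 eqxx orbF.
  have pd : p`_d.+1 = 0.
    move: fv; rewrite fp hev_infinity // => /eqP.
    by rewrite mulf_eq0 expf_eq0 (negPf v1) andbF orbF => /eqP.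
  have sp' : (size p <= d.+1)%N.
    by apply/leq_sizeP => j; rewrite leq_eqVlt => /predU1P[<- //|dj];
      apply: nth_default; apply: leq_trans sp _.
  exists (fun w => - v.1^-1 * hev d p w); first exact/isformZ/isform_hev.
  move=> w; have -> : (w.1 * v.2 - w.2 * v.1) * (- v.1^-1 * hev d p w) =
      w.2 * hev d p w by rewrite v2; field.
  rewrite fp /hev big_ord_recr /= pd !mul0r addr0 mulr_sumr.
  apply: eq_bigr => i _; have id : (i <= d)%N by rewrite -ltnS.
  by rewrite subSn // exprS; ring.
have /factor_theorem[q pq] : root p (v.1 / v.2).
  move: fv; rewrite fp hev_affine // => /eqP.
  by rewrite mulf_eq0 expf_eq0 (negPf v2) andbF.
have sq : (size q <= d.+1)%N.
  have [->|qn] := eqVneq q 0; first by rewrite size_poly0.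
  by move: sp; rewrite pq size_Mmonic ?monicXsubC // size_XsubC addn2.
exists (fun w => v.2^-1 * hev d q w); first exact/isformZ/isform_hev.
move=> w; rewrite fp pq -[d.+1]addn1 hevM ?size_XsubC //.
have -> : hev 1 ('X - (v.1 / v.2)%:P) w = w.1 - v.1 / v.2 * w.2.
  rewrite /hev !big_ord_recr big_ord0 /= !coefB !coefX !coefC /=; ring.
by field.
Qed.

(** For nonzero pairs this is equality of points of the projective line. The zero pair is [par] to
    everything, hence the nonzero middle term in [par_trans]. *)
Definition par v w : Prop := v.1 * w.2 = v.2 * w.1.

Lemma par_sym v w : par v w -> par w v.
Proof. by rewrite /par => h; rewrite mulrC -h mulrC. Qed.

Lemma par_scale v w : v != 0 -> w != 0 -> par v w ->
  exists2 c, c != 0 & w = (c * v.1, c * v.2).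
Proof.
case: v w => [a b] [c d]; rewrite /par !pair_neq0 /= => vn wn e.
have [a0|a0] := eqVneq a 0.
  have b0 : b != 0 by move: vn; rewrite a0 eqxx.
  have c0 : c = 0.
    by move/eqP: e; rewrite a0 mul0r eq_sym mulf_eq0 (negPf b0) => /eqP.
  exists (d / b); last by rewrite a0 c0 mulr0 divfK.
  by rewrite mulf_neq0 ?invr_eq0 //; move: wn; rewrite c0 eqxx.
have ed : d = c / a * b by apply: (mulfI a0); rewrite e; field.
exists (c / a); last by rewrite divfK // -ed.
rewrite mulf_neq0 ?invr_eq0 //; apply: contraTneq wn => c0.
by rewrite ed c0 !mul0r eqxx.
Qed.

Lemma par_trans v u w : u != 0 -> par v u -> par u w -> par v w.
Proof.
move=> un vu uw.
have [->|wn] := eqVneq w 0; first by rewrite /par !mulr0.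
have [c _ ->] := par_scale un wn uw.
by rewrite /par /= mulrCA vu; ring.
Qed.

(** A pair of forms of degree [d] without common zeros is a morphism of degree
    [d] from the projective line to itself. *)
Definition ratmap d (F : K * K -> K * K) : Prop :=
  [/\ isform d (fun v => (F v).1), isform d (fun v => (F v).2)
    & forall v, v != 0 -> F v != 0].

Lemma par_ratmap d F v w : ratmap d F -> v != 0 -> w != 0 -> par v w ->
  par (F v) (F w).
Proof.
move=> [F1 F2 _] vn wn /(par_scale vn wn)[c _ ->].
by rewrite /par (isform_scale _ _ F1) (isform_scale _ _ F2); ring.
Qed.

Lemma ratmap0 F v w : ratmap 0 F -> F v = F w.
Proof.
move=> [F1 F2 _]; rewrite [F v]surjective_pairing [F w]surjective_pairing.
by congr (_, _); [exact: isform_deg0 F1|exact: isform_deg0 F2].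
Qed.

(** Two representations by forms agree wherever both make sense, and one of
    least degree has no common zeros, since a common linear factor could be
    divided out. *)
Lemma ratmap_of_local (r : K * K -> K * K) :
  (forall v, v != 0 -> r v != 0) ->
  (forall v, v != 0 -> exists d F e g,
     [/\ isform d (fun v => (F v).1) /\ isform d (fun v => (F v).2), isform e g,
         F v != 0, g v != 0 &
         forall w, w != 0 -> g w != 0 -> par (r w) (F w)]) ->
  exists d F, ratmap d F /\ forall v, v != 0 -> par (r v) (F v).
Proof.
move=> rn loc.
(* Of the local data, [generic] keeps only that [F] and [g] do not vanish identically, which
   survives the division by a linear factor. *)
pose generic d F := exists e g,
  [/\ isform d (fun v => (F v).1) /\ isform d (fun v => (F v).2), isform e g,
      exists v, F v != 0, exists v, g v != 0 &
      forall w, w != 0 -> g w != 0 -> par (r w) (F w)].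
have [d [F [e [g [[F1 F2] hg _ gn rF]]] Fn]] :
    exists d, exists2 F, generic d F & forall v, v != 0 -> F v != 0.
  have [d [F genF]] : exists d F, generic d F.
    have [d [F [e [g [? ? ? ? ?]]]]] := loc (1, 0) infinity_neq0.
    by exists d, F, e, g; split=> //; exists (1, 0).
  (* Descent on the degree: the linear form of a common zero is divided out of both components and
     multiplied into [g], which excludes its zeros from the comparison with [r]. *)
  elim: d => [|d IH] in F genF *.
    have [e [g [[F1 F2] hg [v Fv] gn rF]]] := genF.
    exists 0%N, F => // w _; move: Fv; rewrite !pair_neq0.
    by rewrite (isform_deg0 v w F1) (isform_deg0 v w F2).
  have [|/existsNP[v /not_implyP[vn /negP]]] :=
    pselect (forall v, v != 0 -> F v != 0); first by exists d.+1, F.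
  rewrite negbK => /eqP Fv.
  have [e [g [[F1 F2] hg [u Fu] gn rF]]] := genF.
  have [F1' h1 E1] := isform_divl vn F1 (congr1 fst Fv).
  have [F2' h2 E2] := isform_divl vn F2 (congr1 snd Fv).
  pose l w := w.1 * v.2 - w.2 * v.1.
  have hl : isform 1 l.
    by apply: isformB; [exact: isformM isform_fst (isformC _)
                       |exact: isformM isform_snd (isformC _)].
  apply: (IH (fun w => (F1' w, F2' w))); exists (1 + e)%N, (fun w => l w * g w).
  split=> //; first exact: isformM.
  - exists u; move: Fu; rewrite !pair_neq0 E1 E2 /=.
    by rewrite !mulf_eq0 !negb_or -!/(l u); case: (l u == 0).
  - have ln : exists w, l w != 0.
      exists u; move: Fu; rewrite !pair_neq0 E1 E2 -!/(l u).
      by apply: contraTneq => ->; rewrite !mul0r eqxx.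
    by have [w] := isform_nonzero hl hg ln gn; exists w.
  move=> w wn; rewrite mulf_eq0 negb_or => /andP[lw gw].
  have := rF w wn gw; rewrite /par /= E1 E2 -!/(l w) => h.
  by apply: (mulfI lw); rewrite mulrCA h; ring.
exists d, F; split=> // v vn.
have [d' [F' [e' [g' [[F1' F2'] hg' Fv' gv' rF']]]]] := loc v vn.
(* The [F] without common zeros is compared with the local [F'] at [v]: their cross product is a
   form that vanishes where [g] and [g'] do not, hence everywhere. *)
have cross : isform (d + d') (fun w => (F w).1 * (F' w).2 - (F w).2 * (F' w).1).
  exact: isformB (isformM F1 F2') (isformM F2 F1').
have FF' w : par (F w) (F' w).
  have [u _ gu] := isform_nonzero hg hg' gn (ex_intro _ v gv').
  apply/eqP; rewrite -subr_eq0; apply/eqP.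
  apply: (isform_cancel cross (isformM hg hg') (ex_intro _ u gu)) => {}w wn.
  rewrite mulf_eq0 negb_or => /andP[gw gw'].
  apply/eqP; rewrite subr_eq0; apply/eqP.
  exact: par_trans (rn w wn) (par_sym (rF w wn gw)) (rF' w wn gw').
exact: par_trans Fv' (rF' v vn gv') (par_sym (FF' v)).
Qed.

End BinaryForms.

(** * Resultants and the intersection of parametrized curves *)

Section Resultant.
Variable K : closedFieldType.
Implicit Types (p q : {poly K}) (v w : K * K).

(** The Sylvester matrix for formal degrees [m] and [n]: unlike
    [Sylvester_mx], its size does not depend on [p] and [q], so that it stays
    polynomial in parameters and detects common zeros at infinity. *)
Definition sylvester m n p q : 'M[K]_(n + m) :=
  \matrix_(i, j) (match fintype.split i with
                  | inl i => 'X^i * p | inr i => 'X^i * q end)`_j.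

(** If [p] has exact degree [m] and is coprime to [q], it divides [s], whose degree is too small;
    then [s] and [u] both vanish. So there is a common root. The case of exact degree [n] of [q] is
    symmetric, and if both degrees drop, infinity is a common zero. *)
Lemma common_zero_of_dependence m n p q (u s : {poly K}) :
  (size p <= m.+1)%N -> (size q <= n.+1)%N ->
  (size u <= n)%N -> (size s <= m)%N -> (u != 0) || (s != 0) ->
  u * p + s * q = 0 ->
  exists v, [/\ v != 0, hev m p v = 0 & hev n q v = 0].
Proof.
have affine_case m' n' (p' q' u' s' : {poly K}) : size p' = m'.+1 ->
    (size q' <= n'.+1)%N ->
    (size s' <= m')%N -> (u' != 0) || (s' != 0) -> u' * p' + s' * q' = 0 ->
    exists v, [/\ v != 0, hev m' p' v = 0 & hev n' q' v = 0].
  move=> sp sq ss us0 e.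
  have pn : p' != 0 by rewrite -size_poly_gt0 sp.
  have [cpq|ncpq] := boolP (coprimep p' q').
    have : p' %| s'.
      rewrite -(Gauss_dvdpl _ cpq); apply/dvdpP; exists (- u').
      by rewrite mulNr; apply/eqP; rewrite -addr_eq0 addrC e.
    have [s0 _|sn /dvdp_leq] := eqVneq s' 0; last first.
      by move=> /(_ sn); rewrite sp leqNgt ltnS ss.
    move: e us0; rewrite s0 mul0r addr0 => /eqP; rewrite mulf_eq0 (negPf pn).
    by rewrite orbF => ->; rewrite eqxx.
  have /closed_rootP[x] : size (gcdp p' q') != 1%N := ncpq.
  rewrite root_gcd => /andP[/rootP px /rootP qx].
  exists (x, 1); split; first exact: point_neq0.
    by rewrite hev_affine ?sp //= ?oner_eq0 // divr1 px mulr0.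
  by rewrite hev_affine //= ?oner_eq0 // divr1 qx mulr0.
move=> sp sq su ss us0 e.
have [pm|pm] := ltnP m (size p).
  by apply: (affine_case m n p q u s) => //; apply/eqP; rewrite eqn_leq sp.
have [qn|qn] := ltnP n (size q).
  have [|||v [vn qv pv]] := affine_case n m q p s u _ sp su _ _.
  - by apply/eqP; rewrite eqn_leq sq.
  - by rewrite orbC.
  - by rewrite addrC.
  by exists v.
exists (1, 0); split; first exact: infinity_neq0.
  by rewrite hev_infinity // nth_default ?mul0r.
by rewrite hev_infinity // nth_default ?mul0r.
Qed.

Let split_lshift m n (i : 'I_m) : fintype.split (lshift n i) = inl i.
Proof. exact: (unsplitK (inl i)). Qed.

Let split_rshift m n (i : 'I_n) : fintype.split (rshift m i) = inr i.
Proof. exact: (unsplitK (inr i)). Qed.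

Lemma sylvester_common_zero m n p q :
  (size p <= m.+1)%N -> (size q <= n.+1)%N -> \det (sylvester m n p q) = 0 ->
  exists v, [/\ v != 0, hev m p v = 0 & hev n q v = 0].
Proof.
move=> sp sq /eqP/det0P[x xn xS].
(* The two blocks of a left kernel vector are the coefficients of the cofactors [u] and [s]. *)
pose u := \poly_(i < n) (if insub i is Some i then x 0 (lshift m i) else 0).
pose s := \poly_(i < m) (if insub i is Some i then x 0 (rshift n i) else 0).
apply: (@common_zero_of_dependence m n p q u s) => //; rewrite ?size_poly //.
  apply: contraNT xn; rewrite negb_or !negbK => /andP[/eqP u0 /eqP s0].
  apply/eqP/rowP => k; rewrite mxE -(splitK k); case: (fintype.split k) => i /=.
    have := congr1 (fun r : {poly K} => r`_i) u0.
    by rewrite coef_poly ltn_ord valK coef0.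
  have := congr1 (fun r : {poly K} => r`_i) s0.
  by rewrite coef_poly ltn_ord valK coef0.
have uE : u = \sum_(i < n) x 0 (lshift m i) *: 'X^i.
  by rewrite /u poly_def; apply: eq_bigr => i _; rewrite valK.
have sE : s = \sum_(i < m) x 0 (rshift n i) *: 'X^i.
  by rewrite /s poly_def; apply: eq_bigr => i _; rewrite valK.
have size_le : (size (u * p + s * q)%R <= n + m)%N.
  apply: leq_trans (size_polyD _ _) _; rewrite geq_max size_mul_le ?size_poly //=.
  by rewrite addnC size_mul_le ?size_poly.
apply/polyP => j; rewrite coef0.
have [jnm|jnm] := ltnP j (n + m); last by rewrite nth_default // (leq_trans _ jnm).
have := congr1 (fun y : 'rV_(n + m) => y 0 (Ordinal jnm)) xS.
rewrite mxE [RHS]mxE big_split_ord /= => h; rewrite -[RHS]h.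
rewrite coefD uE sE !mulr_suml !coef_sum; congr (_ + _); apply: eq_bigr => i _.
  by rewrite mxE split_lshift -scalerAl coefZ.
by rewrite mxE split_rshift -scalerAl coefZ.
Qed.

(** Two curves on [P^1 x P^1] that are parametrized with bidegrees [(d1, d2)]
    and [(e1, e2)] have intersection number [d1 e2 + d2 e1]. *)
Lemma disjoint_curves d1 d2 e1 e2 (F1 F2 G1 G2 : K * K -> K * K) :
  ratmap d1 F1 -> ratmap d2 F2 -> ratmap e1 G1 -> ratmap e2 G2 ->
  (forall v w, v != 0 -> w != 0 -> par (F1 v) (G1 w) -> ~ par (F2 v) (G2 w)) ->
  (d1 * e2 + d2 * e1 = 0)%N.
Proof.
move=> [[p sp pE] [p' sp' pE'] _] [[q sq qE] [q' sq' qE'] _] G1r G2r dis.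
have [G1f G1s _] := G1r; have [G2f G2s _] := G2r.
(* At [v], the forms of [P w] and [Q w] are the cross products of [F1 v] with [G1 w] and of [F2 v]
   with [G2 w]; a common zero is a point where the curves meet. *)
pose P w := (G1 w).2 *: p - (G1 w).1 *: p'.
pose Q w := (G2 w).2 *: q - (G2 w).1 *: q'.
have sP w : (size (P w) <= d1.+1)%N.
  by apply: leq_trans (size_polyD _ _) _; rewrite size_polyN geq_max
    !(leq_trans (size_scale_leq _ _)).
have sQ w : (size (Q w) <= d2.+1)%N.
  by apply: leq_trans (size_polyD _ _) _; rewrite size_polyN geq_max
    !(leq_trans (size_scale_leq _ _)).
have hevB d (a a' : {poly K}) c c' v :
    hev d (c *: a - c' *: a') v = c * hev d a v - c' * hev d a' v.
  rewrite /hev !mulr_sumr -sumrB; apply: eq_bigr => i _.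
  by rewrite coefB !coefZ; ring.
(* The [d2] shifts of [P w] have degree [e1] in [w] and the [d1] shifts of [Q w] have degree [e2],
   so the degree of the resultant is the intersection number. *)
pose deg (i : 'I_(d2 + d1)) := if fintype.split i is inl _ then e1 else e2.
have : isform (\sum_i deg i) (fun w => \det (sylvester d1 d2 (P w) (Q w))).
  apply: isform_det => i j; rewrite /deg.
  case si: (fintype.split i) => [k|k];
    [apply: (@isform_ext _ _ (fun w =>
       ('X^k * p)`_j * (G1 w).2 - ('X^k * p')`_j * (G1 w).1))
    |apply: (@isform_ext _ _ (fun w =>
       ('X^k * q)`_j * (G2 w).2 - ('X^k * q')`_j * (G2 w).1))];
    try by [apply: isformB; exact: isformZ];
    by move=> w; rewrite mxE si mulrBr -!scalerAr coefB !coefZ; ring.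
have -> : (\sum_i deg i = d1 * e2 + d2 * e1)%N.
  rewrite big_split_ord /= addnC; congr (_ + _)%N.
    by under eq_bigr => i _ do rewrite /deg split_rshift;
      rewrite sum_nat_const card_ord.
  by under eq_bigr => i _ do rewrite /deg split_lshift;
    rewrite sum_nat_const card_ord.
have [//|dpos] := posnP (d1 * e2 + d2 * e1); move=> /(isform_root dpos)[w wn].
move=> /(sylvester_common_zero (sP w) (sQ w))[v [vn Pv Qv]].
exfalso; apply: (dis v w vn wn).
  rewrite /par pE pE'; apply/eqP; rewrite -subr_eq0; apply/eqP.
  by rewrite -Pv hevB; ring.
rewrite /par qE qE'; apply/eqP; rewrite -subr_eq0; apply/eqP.
by rewrite -Qv hevB; ring.
Qed.

(** The composite is a pair of forms of degree [d * e] with dehomogenizations ['X * q] and [q]. A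
    root of [q] would be a common zero, so [q] is constant; if [d * e] exceeded 1, infinity would be
    one. *)
Lemma ratmap_degree1 d e F G : ratmap d F -> ratmap e G ->
  (forall v, v != 0 -> par (G (F v)) v) -> d = 1%N.
Proof.
move=> [F1 F2 Fn] [G1 G2 Gn] GF.
have FE v : F v = ((F v).1, (F v).2) by case: (F v).
have [p sp pE] := isform_comp G1 F1 F2; have [q sq qE] := isform_comp G2 F1 F2.
have nz v : v != 0 -> ~ (hev (d * e) p v = 0 /\ hev (d * e) q v = 0).
  move=> vn; rewrite -pE -qE -FE => -[p0 q0].
  by have := Gn _ (Fn _ vn); rewrite pair_neq0 p0 q0 eqxx.
have pq : p = 'X * q.
  have sp1 : (size p <= (d * e).+2)%N by exact: leq_trans sp _.
  have sq1 : (size ('X * q)%R <= (d * e).+2)%N.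
    by apply: leq_trans (size_polyMleq _ _) _; rewrite size_polyX.
  apply/eqP; rewrite -subr_eq0; apply: contraT => /closed_nonrootP[x].
  rewrite /root hornerD hornerN hornerM hornerX subr_eq0.
  have := GF (x, 1) (point_neq0 x); rewrite /par FE pE qE /=.
  rewrite !hev_affine //= ?oner_eq0 // divr1 !expr1n !mul1r mulr1 => ->.
  by rewrite mulrC eqxx.
have sq1 : size q = 1%N.
  apply/eqP; apply: contraT => /closed_rootP[x /rootP qx].
  case: (nz (x, 1) (point_neq0 x)).
  by rewrite !hev_affine //= ?oner_eq0 // divr1 pq hornerM qx !mulr0.
have qn : q != 0 by rewrite -size_poly_gt0 sq1.
have sp2 : size p = 2%N by rewrite pq mulrC size_mulX // sq1.
have : (d * e = 1)%N.
  apply/eqP; rewrite eqn_leq andbC; move: sp; rewrite sp2 ltnS => ->.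
  rewrite leqNgt; apply/negP => de.
  case: (nz (1, 0) (infinity_neq0 K)).
  by rewrite !hev_infinity // !nth_default ?mul0r // ?sp2 ?sq1 // ltnW.
by move=> /eqP; rewrite muln_eq1 => /andP[/eqP].
Qed.

Lemma isform1E (f : K * K -> K) : isform 1 f ->
  exists a b : K, forall v, f v = a * v.1 + b * v.2.
Proof.
move=> [p _ fp]; exists p`_1, p`_0 => v.
by rewrite fp /hev !big_ord_recr big_ord0 /=; ring.
Qed.

End Resultant.

(** * Automorphisms of the product of two lines *)

Section ProductOfLines.
Variable K : closedFieldType.
Implicit Types (a v : K * K) (h : K * K -> K * K -> K * K).

Lemma e1_neq0 : (1, 0) != 0 :> K * K. Proof. exact: infinity_neq0. Qed.
Lemma e2_neq0 : (0, 1) != 0 :> K * K. Proof. exact: point_neq0. Qed.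
Local Hint Resolve e1_neq0 e2_neq0 : core.

Lemma not_par_e12 : ~ @par K (1, 0) (0, 1).
Proof. by rewrite /par /= !mulr1 mulr0 => /eqP; rewrite oner_eq0. Qed.

Definition rational (r : K * K -> K * K) : Prop :=
  exists d F, ratmap d F /\ forall v, v != 0 -> par (r v) (F v).

(** [(a, v) |-> (h1 a v, h2 a v)] in homogeneous coordinates; that its
    inverse is regular is not recorded. *)
Record aut_P1P1 h1 h2 : Prop := AutP1P1 {
  aut_neq0 : forall a v, a != 0 -> v != 0 -> h1 a v != 0 /\ h2 a v != 0;
  aut_inj : forall a v a' v', a != 0 -> v != 0 -> a' != 0 -> v' != 0 ->
    par (h1 a v) (h1 a' v') -> par (h2 a v) (h2 a' v') -> par a a' /\ par v v';
  aut_surj : forall b w, b != 0 -> w != 0 ->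
    exists a v, [/\ a != 0, v != 0, par (h1 a v) b & par (h2 a v) w];
  aut_rational : forall a, a != 0 -> rational (h1 a) /\ rational (h2 a);
  aut_rational' : forall v, v != 0 -> rational (h1^~ v) /\ rational (h2^~ v) }.

Lemma aut_P1P1_swap h1 h2 : aut_P1P1 h1 h2 -> aut_P1P1 h2 h1.
Proof.
move=> [n i s r r']; split.
- by move=> a v an vn; have [] := n a v an vn.
- by move=> a v a' v' ? ? ? ? ? ?; apply: i.
- by move=> b w bn wn; have [a [v [? ? ? ?]]] := s w b wn bn; exists a, v.
- by move=> a /r[].
- by move=> v /r'[].
Qed.

Lemma aut_P1P1_flip h1 h2 : aut_P1P1 h1 h2 ->
  aut_P1P1 (fun v a => h1 a v) (fun v a => h2 a v).
Proof.
move=> [n i s r r']; split=> //.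
- by move=> a v an vn; apply: n.
- move=> a v a' v' ? ? ? ? ? ?.
  by have [] : par v v' /\ par a a' by apply: i.
- by move=> b w bn wn; have [a [v [? ? ? ?]]] := s b w bn wn; exists v, a.
Qed.

Section Rulings.
Variables h1 h2 : K * K -> K * K -> K * K.
Hypothesis H : aut_P1P1 h1 h2.

Let constant (r : K * K -> K * K) :=
  forall v v', v != 0 -> v' != 0 -> par (r v) (r v').

Let constant_deg0 r F : ratmap 0 F -> (forall v, v != 0 -> par (r v) (F v)) ->
  constant r.
Proof.
move=> hF rF v v' vn vn'; have [_ _ Fn] := hF.
apply: (@par_trans _ _ (F v)); [exact: Fn|exact: rF|].
by rewrite (ratmap0 v v' hF); apply/par_sym/rF.
Qed.

Let not_both_constant a : a != 0 -> constant (h1 a) -> constant (h2 a) -> False.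
Proof.
move=> an c1 c2; apply: not_par_e12.
have [] // := aut_inj H an e1_neq0 an e2_neq0; [exact: c1|exact: c2].
Qed.

(** By injectivity two distinct lines have disjoint images, so both [d1 * e2] and [d2 * e1] vanish.
    No line is contracted in both coordinates, so the vanishing degrees belong to the same
    coordinate. *)
Let constant_pair a a' : a != 0 -> a' != 0 -> ~ par a a' ->
  (constant (h1 a) /\ constant (h1 a')) \/ (constant (h2 a) /\ constant (h2 a')).
Proof.
move=> an an' aa'.
have [[d1 [F1 [F1r F1h]]] [d2 [F2 [F2r F2h]]]] := aut_rational H an.
have [[e1 [G1 [G1r G1h]]] [e2 [G2 [G2r G2h]]]] := aut_rational H an'.
have /eqP : (d1 * e2 + d2 * e1 = 0)%N.
  apply: (disjoint_curves F1r F2r G1r G2r) => v w vn wn p1 p2.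
  have [_ _ F1n] := F1r; have [_ _ F2n] := F2r.
  have [_ _ G1n] := G1r; have [_ _ G2n] := G2r.
  have [] // := aut_inj H an vn an' wn.
    apply: par_trans (F1n v vn) (F1h v vn) _.
    exact: par_trans (G1n w wn) p1 (par_sym (G1h w wn)).
  apply: par_trans (F2n v vn) (F2h v vn) _.
  exact: par_trans (G2n w wn) p2 (par_sym (G2h w wn)).
rewrite addn_eq0 !muln_eq0 => /andP[].
have c d r F : ratmap d F -> (forall v, v != 0 -> par (r v) (F v)) ->
    d == 0%N -> constant r.
  by move=> hF rF /eqP d0; apply: constant_deg0 rF; rewrite -d0.
move=> /orP[/(c _ _ _ F1r F1h)|/(c _ _ _ G2r G2h)] c1
       /orP[/(c _ _ _ F2r F2h)|/(c _ _ _ G1r G1h)] c2.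
- by case: (not_both_constant an c1 c2).
- by left.
- by right.
- by case: (not_both_constant an' c2 c1).
Qed.

(** The coordinate found by [constant_pair] for the lines [(1, 0)] and [(0, 1)] serves for all
    lines: any other line differs from at least one of these two. *)
Lemma rulings : (forall a, a != 0 -> constant (h1 a)) \/
  (forall a, a != 0 -> constant (h2 a)).
Proof.
have spread (c c' : K * K -> Prop) :
    (forall a a', a != 0 -> a' != 0 -> ~ par a a' ->
      (c a /\ c a') \/ (c' a /\ c' a')) ->
    (forall a, a != 0 -> c a -> c' a -> False) ->
    c (1, 0) -> c (0, 1) -> forall a, a != 0 -> c a.
  move=> pairs notboth c1 c2 a an.
  have [a1|a1] := pselect (par (1, 0) a).
    have a2 : ~ par (0, 1) a.
      by move=> /par_sym /(par_trans an a1) /not_par_e12.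
    have [[]//|[c2' _]] := pairs _ _ e2_neq0 an a2.
    by case: (notboth _ e2_neq0 c2 c2').
  have [[]//|[c1' _]] := pairs _ _ e1_neq0 an a1.
  by case: (notboth _ e1_neq0 c1 c1').
have [[c1 c2]|[c1 c2]] := constant_pair e1_neq0 e2_neq0 not_par_e12.
  left; apply: (spread _ (fun a => constant (h2 a))) c1 c2.
    exact: constant_pair.
  exact: not_both_constant.
right; apply: (spread _ (fun a => constant (h1 a))) c1 c2.
  by move=> a a' an an' /(constant_pair an an') [?|?]; [right|left].
by move=> a an c2 c1; exact: (not_both_constant an c1 c2).
Qed.

End Rulings.

(** By [rulings] the lines of the other ruling are contracted in one coordinate too. If that were
    [h1] again, [h1] would be constant on the whole surface, against surjectivity. *)
Lemma other_ruling h1 h2 : aut_P1P1 h1 h2 ->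
  (forall a v v', a != 0 -> v != 0 -> v' != 0 -> par (h1 a v) (h1 a v')) ->
  forall a a' v, a != 0 -> a' != 0 -> v != 0 -> par (h2 a v) (h2 a' v).
Proof.
move=> H c1 a a' v an an' vn.
have [c|c] := rulings (aut_P1P1_flip H); last exact: c.
have c1' b w b' w' : b != 0 -> w != 0 -> b' != 0 -> w' != 0 ->
    par (h1 b w) (h1 b' w').
  move=> bn wn bn' wn'; have [hn _] := aut_neq0 H bn wn'.
  exact: par_trans hn (c1 _ _ _ bn wn wn') (c _ wn' _ _ bn bn').
have [b [w [bn wn p1 _]]] := aut_surj H e1_neq0 e1_neq0.
have [b' [w' [bn' wn' p2 _]]] := aut_surj H e2_neq0 e1_neq0.
case: not_par_e12; have [hn _] := aut_neq0 H bn wn.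
have [hn' _] := aut_neq0 H bn' wn'.
exact: par_trans hn (par_sym p1) (par_trans hn' (c1' _ _ _ _ bn wn bn' wn') p2).
Qed.

Lemma aut_P1P1_split h1 h2 : aut_P1P1 h1 h2 ->
  (forall a v v', a != 0 -> v != 0 -> v' != 0 -> par (h1 a v) (h1 a v')) ->
  exists d1 d2 F1 F2, [/\ ratmap d1 F1, ratmap d2 F2 &
    forall a v, a != 0 -> v != 0 -> par (h1 a v) (F1 a) /\ par (h2 a v) (F2 v)].
Proof.
move=> H c1; have c2 := other_ruling H c1.
have [[d1 [F1 [F1r F1h]]] _] := aut_rational' H e1_neq0.
have [_ [d2 [F2 [F2r F2h]]]] := aut_rational H e1_neq0.
exists d1, d2, F1, F2; split=> // a v an vn; split.
  have [hn _] := aut_neq0 H an e1_neq0.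
  exact: par_trans hn (c1 _ _ _ an vn e1_neq0) (F1h _ an).
have [_ hn] := aut_neq0 H e1_neq0 vn.
exact: par_trans hn (c2 _ _ _ an e1_neq0 vn) (F2h _ vn).
Qed.

Lemma aut_P1P1_linear h1 h2 k1 k2 : aut_P1P1 h1 h2 -> aut_P1P1 k1 k2 ->
  (forall a v, a != 0 -> v != 0 ->
     par (k1 (h1 a v) (h2 a v)) a /\ par (k2 (h1 a v) (h2 a v)) v) ->
  (forall a v v', a != 0 -> v != 0 -> v' != 0 -> par (h1 a v) (h1 a v')) ->
  exists F1 F2, [/\ ratmap 1 F1, ratmap 1 F2 &
    forall a v, a != 0 -> v != 0 -> par (h1 a v) (F1 a) /\ par (h2 a v) (F2 v)].
Proof.
move=> H L kh c1.
have [d1 [d2 [F1 [F2 [F1r F2r hF]]]]] := aut_P1P1_split H c1.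
have [_ _ F1n] := F1r; have [_ _ F2n] := F2r.
have [cl|cl] := rulings L; last first.
  (* If the inverse exchanged the rulings, it would recover [a] from [h2] alone, which depends only
     on [v]; then all points [a] would coincide. *)
  case: not_par_e12.
  have [e1 [e2 [G1 [G2 [G1r G2r kG]]]]] := aut_P1P1_split (aut_P1P1_swap L)
    (fun a v v' an vn vn' => cl a an v v' vn vn').
  have [_ _ G2n] := G2r.
  have GF a : a != 0 -> par a (G2 (F2 (1, 0))).
    move=> an; have [n1 n2] := aut_neq0 H an e1_neq0.
    have [m1 m2] := aut_neq0 L n1 n2; have [p1 _] := kh _ _ an e1_neq0.
    apply: par_trans m1 (par_sym p1) _.
    have [_ p2] := kG _ _ n1 n2.
    have [_ p3] := hF _ _ an e1_neq0.
    apply: par_trans (G2n _ n2) p2 _.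
    exact: par_ratmap G2r n2 (F2n _ e1_neq0) p3.
  apply: par_trans (GF _ e1_neq0) (par_sym (GF _ e2_neq0)).
  exact/G2n/F2n.
have [e1 [e2 [G1 [G2 [G1r G2r kG]]]]] := aut_P1P1_split L
  (fun a v v' an vn vn' => cl a an v v' vn vn').
have GF a v : a != 0 -> v != 0 -> par (G1 (F1 a)) a /\ par (G2 (F2 v)) v.
  move=> an vn; have [n1 n2] := aut_neq0 H an vn.
  have [m1 m2] := aut_neq0 L n1 n2.
  have [p1 p2] := kh _ _ an vn; have [q1 q2] := kG _ _ n1 n2.
  have [r1 r2] := hF _ _ an vn.
  have [_ _ G1n] := G1r; have [_ _ G2n] := G2r.
  split; [apply: (par_trans m1 _ p1)|apply: (par_trans m2 _ p2)].
    apply: (par_trans (G1n _ n1) _ (par_sym q1)).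
    exact: par_ratmap G1r (F1n _ an) n1 (par_sym r1).
  apply: (par_trans (G2n _ n2) _ (par_sym q2)).
  exact: par_ratmap G2r (F2n _ vn) n2 (par_sym r2).
have d11 : d1 = 1%N.
  by apply: ratmap_degree1 F1r G1r _ => v vn; have [] := GF v v vn vn.
have d21 : d2 = 1%N.
  by apply: ratmap_degree1 F2r G2r _ => v vn; have [] := GF v v vn vn.
by rewrite d11 in F1r; rewrite d21 in F2r; exists F1, F2.
Qed.

Theorem aut_P1P1_structure h1 h2 k1 k2 : aut_P1P1 h1 h2 -> aut_P1P1 k1 k2 ->
  (forall a v, a != 0 -> v != 0 ->
     par (k1 (h1 a v) (h2 a v)) a /\ par (k2 (h1 a v) (h2 a v)) v) ->
  exists F1 F2, [/\ ratmap 1 F1, ratmap 1 F2 &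
    (forall a v, a != 0 -> v != 0 ->
       par (h1 a v) (F1 a) /\ par (h2 a v) (F2 v)) \/
    (forall a v, a != 0 -> v != 0 ->
       par (h1 a v) (F2 v) /\ par (h2 a v) (F1 a))].
Proof.
move=> H L kh; have [c|c] := rulings H.
  have [F1 [F2 [? ? ?]]] := aut_P1P1_linear H L kh
    (fun a v v' an vn vn' => c a an v v' vn vn').
  by exists F1, F2; split=> //; left.
(* Exchanging the factors of the target of [h] exchanges those of the source of its inverse. *)
have [F1 [F2 [? ? hF]]] := aut_P1P1_linear (aut_P1P1_swap H) (aut_P1P1_flip L) kh
  (fun a v v' an vn vn' => c a an v v' vn vn').
by exists F1, F2; split=> //; right=> a v an vn; have [] := hF a v an vn.
Qed.

End ProductOfLines.

(** * Gluings *)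

Local Open Scope classical_set_scope.

Section MorphismFacts.
Variable K : closedFieldType.
Implicit Types X Y Z : fspace K.

Lemma is_morphism_comp X Y Z (f : X -> Y) (g : Y -> Z) :
  is_morphism f -> is_morphism g -> is_morphism (g \o f).
Proof.
move=> [cf rf] [cg rg]; split=> [x|x u ru].
  by apply: continuous_comp; [exact: cf|exact: cg].
exact: rf (rg _ _ ru).
Qed.

Lemma is_isomorphism_comp X Y Z (f : X -> Y) (g : Y -> Z) :
  is_isomorphism f -> is_isomorphism g -> is_isomorphism (g \o f).
Proof.
move=> [mf [f' [mf' ff' f'f]]] [mg [g' [mg' gg' g'g]]].
split; first exact: is_morphism_comp.
exists (f' \o g'); split; first exact: is_morphism_comp.
  exact: can_comp.
exact: can_comp.
Qed.

Lemma is_isomorphism_inv X Y (f : X -> Y) : is_isomorphism f ->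
  exists g : Y -> X, [/\ is_isomorphism g, cancel f g & cancel g f].
Proof.
move=> [mf [g [mg fg gf]]]; exists g; split=> //.
by split=> //; exists f.
Qed.

Lemma is_morphism_sub X Y (A : set X) (B : set Y) (f : X -> Y)
    (g : subspace_of A -> subspace_of B) :
  is_morphism f -> (forall x, val (g x) = f (val x)) -> is_morphism g.
Proof.
move=> [cf rf] gf.
have fval : continuous (f \o (val : subspace_of A -> X)).
  by move=> x; apply: continuous_comp; [exact: initial_continuous|exact: cf].
have cg : continuous g.
  apply/continuousP => _ [U oU <-].
  rewrite (_ : _ @^-1` _ = (f \o val) @^-1` U).
    by move/continuousP: fval; apply.
  by rewrite /preimage; apply/seteqP; split=> x /=; rewrite set_valE gf.
split=> // x u [w rw uw]; exists (w \o f); first by apply: rf; rewrite -gf.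
have {}uw : \forall y \near x, u (g y) = w (val (g y)) by exact: cg uw.
by apply: filterS uw => y /= ->; rewrite gf.
Qed.

End MorphismFacts.

Section GluingFacts.
Context {K : closedFieldType} {X0 X1 : fspace K} {A0 : set X0} {A1 : set X1}.
Implicit Types h : subspace_of A0 -> subspace_of A1.

Lemma glue_in0_morphism h : is_morphism (glue_in0 h : X0 -> gluing h).
Proof.
split; first exact: glue_in0_continuous.
by move=> x f /nbhs_singleton[/(_ x erefl)].
Qed.

Lemma glue_in1_morphism h : is_morphism (glue_in1 h : X1 -> gluing h).
Proof.
split; first exact: glue_in1_continuous.
by move=> x f /nbhs_singleton[_ /(_ x erefl)].
Qed.

(** Half of the universal property of a pushout: continuity and regularity on the gluing are both
    tested on the two pieces. *)
Lemma gluing_morphism h (Z : fspace K) (G : gluing h -> Z) :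
  is_morphism (G \o glue_in0 h) -> is_morphism (G \o glue_in1 h) ->
  is_morphism G.
Proof.
move=> [c0 r0] [c1 r1].
have cG : continuous G.
  apply/quotient_continuous; case=> -[] x U GU; [exact: c1 GU|exact: c0 GU].
split=> // p f /regular_at_open fG.
have {}fG : \forall q \near p, regular_at (G q) f by exact: cG fG.
by apply: filterS fG => q rq; split=> x xq; [apply: r0|apply: r1]; rewrite /= xq.
Qed.

Lemma glue_pi_eq h (p q : glue_union) :
  clos_refl_sym_trans _ (glue_step h) p q -> glue_pi h p = glue_pi h q.
Proof. by move=> pq; apply/eqmodP/asboolP. Qed.

Lemma glue_eq h a : glue_in0 h (val a) = glue_in1 h (val (h a)).
Proof. by apply: glue_pi_eq; apply: rst_step; exists a. Qed.

Lemma gluing_cases h (p : gluing h) :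
  (exists x, p = glue_in0 h x) \/ (exists y, p = glue_in1 h y).
Proof.
rewrite -[p]reprK; case: (repr p) => -[] x; first by right; exists x.
by left; exists x.
Qed.

Lemma gluing_lift h (Z : Type) (f0 : X0 -> Z) (f1 : X1 -> Z) :
  (forall a, f0 (val a) = f1 (val (h a))) ->
  exists G : gluing h -> Z, G \o glue_in0 h =1 f0 /\ G \o glue_in1 h =1 f1.
Proof.
move=> f01.
pose g (p : glue_union) : Z :=
  match p with existT b x => (if b return glue_piece b -> Z then f1 else f0) x end.
have gP p q : clos_refl_sym_trans _ (glue_step h) p q -> g p = g q.
  elim=> [_ _ [a [-> ->]]|//|? ? _ ->//|? ? ? _ -> _ ->//]; exact: f01.
have Gpi p : g (repr (glue_pi h p)) = g p.
  by have /eqmodP/asboolP/gP := reprK (glue_pi h p).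
by exists (g \o repr); split=> x; exact: Gpi.
Qed.

(** The identity of [X0] and [F] on [X1] respect the identifications and so descend; the inverse of
    [F] gives the inverse map in the same way. *)
Lemma gluing_isomorphic h h' (F : X1 -> X1) : is_isomorphism F ->
  (forall a, F (val (h a)) = val (h' a)) -> isomorphic (gluing h) (gluing h').
Proof.
move=> [mF [F' [mF' FF' F'F]]] Fh.
have lift (k k' : subspace_of A0 -> subspace_of A1) (f : X1 -> X1) :
    is_morphism f ->
    (forall a, f (val (k a)) = val (k' a)) ->
    exists G : gluing k -> gluing k', [/\ is_morphism G,
      forall x, G (glue_in0 k x) = glue_in0 k' x &
      forall y, G (glue_in1 k y) = glue_in1 k' (f y)].
  move=> mf fk; have [a|G [G0 G1]] :=
    @gluing_lift k _ (glue_in0 k') (glue_in1 k' \o f).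
    by rewrite /= fk glue_eq.
  exists G; split; [|exact: G0|exact: G1].
  apply: gluing_morphism.
    by rewrite (funext G0); exact: glue_in0_morphism.
  rewrite (funext G1); apply: is_morphism_comp mf _; exact: glue_in1_morphism.
have [G [mG G0 G1]] := lift h h' F mF Fh.
have F'h a : F' (val (h' a)) = val (h a) by rewrite -Fh FF'.
have [G' [mG' G'0 G'1]] := lift h' h F' mF' F'h.
exists G; split=> //; exists G'; split=> // p.
  by have [[x ->]|[y ->]] := gluing_cases p; rewrite ?G0 ?G'0 // G1 G'1 FF'.
by have [[x ->]|[y ->]] := gluing_cases p; rewrite ?G'0 ?G0 // G'1 G1 F'F.
Qed.

End GluingFacts.

(** * Isometries of the quadric *)

Section Projective.
Variables (K : closedFieldType) (n : nat).
Implicit Types (L : proj_pt K n) (v w : 'rV[K]_n.+1) (f : {mpoly K[n.+1]}).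

(** Homogeneous coordinates, namely those used by [peval]. They are a choice, so maps determine them
    only up to a nonzero factor. *)
Definition hcoord L : 'rV[K]_n.+1 := vpick (val L).

Lemma pevalE f L : peval f L = f.@[hcoord L 0]. Proof. by []. Qed.

Lemma hcoord_neq0 L : hcoord L != 0.
Proof. by case: L => L dL; rewrite vpick0 -dimv_eq0 /= (eqP dL). Qed.

Lemma val_hcoord L : val L = <[hcoord L]>%VS.
Proof.
apply/esym/eqP; rewrite eqEdim -memvE memv_pick dim_vline hcoord_neq0.
by case: L => L /= /eqP ->.
Qed.

Lemma hcoord_inj L L' c : c != 0 -> hcoord L = c *: hcoord L' -> L = L'.
Proof.
move=> cn e; apply: val_inj; rewrite !val_hcoord e.
apply/eqP; rewrite eqEdim !dim_vline scaler_eq0 (negPf cn) !hcoord_neq0 leqnn.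
by rewrite andbT -memvE memvZ // memv_line.
Qed.

Lemma exists_point v : v != 0 -> exists L c, c != 0 /\ hcoord L = c *: v.
Proof.
move=> vn.
have dv : \dim <[v]>%VS == 1%N by rewrite dim_vline vn.
have /vlineP[c e] := memv_pick <[v]>%VS.
exists (exist _ <[v]>%VS dv), c; split=> //.
apply: contraTneq (hcoord_neq0 (exist _ <[v]>%VS dv)) => c0.
by rewrite /hcoord /= e c0 scale0r eqxx.
Qed.

Lemma meval_dhomog d f c v : f \is d.-homog ->
  f.@[(c *: v) 0] = c ^+ d * f.@[v 0].
Proof.
move=> fd; rewrite !mevalE mulr_sumr; apply: eq_big_seq => m mf.
have dE : d = mdeg m := esym (dhomog_mf fd mf).
have -> : \prod_i (c *: v) 0 i ^+ m i = c ^+ d * \prod_i v 0 i ^+ m i.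
  under eq_bigr do rewrite mxE exprMn.
  by rewrite big_split prodrXr dE mdegE.
by rewrite mulrCA.
Qed.

(** The coordinates of [v *m M] as linear forms in those of [v]; substituting them into [f] pulls
    [f] back along [M]. *)
Definition mx_form (M : 'M[K]_n.+1) : n.+1.-tuple {mpoly K[n.+1]} :=
  [tuple \sum_j M j i *: 'X_j | i < n.+1].

Lemma mx_formE M f v : (f \mPo mx_form M).@[v 0] = f.@[(v *m M) 0].
Proof.
rewrite comp_mpoly_meval; apply: meval_eq => i; rewrite tnth_mktuple mxE.
rewrite rmorph_sum; apply: eq_bigr => j _ /=.
by rewrite mevalZ mevalXU mulrC.
Qed.

Lemma comp_mx_form_dhomog d M f : f \is d.-homog ->
  f \mPo mx_form M \is d.-homog.
Proof.
move=> fd; rewrite comp_mpolyE big_seq; apply: rpred_sum => m mf.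
have dE : d = mdeg m := esym (dhomog_mf fd mf).
apply: dhomogZ; rewrite dE mdegE.
elim/big_ind2: _ => [|? ? ? ? h1 h2|i _]; first exact: dhomog1.
  exact: dhomogM.
rewrite -[X in X.-homog]mul1n; apply: dhomogMn; rewrite tnth_mktuple.
by apply: rpred_sum => j _; apply: dhomogZ; rewrite dhomogX /= mdeg1.
Qed.

Lemma mx_projective M : M \in unitmx ->
  exists F : proj_space K n -> proj_space K n, is_morphism F /\
  forall L, exists c, c != 0 /\ hcoord (F L) = c *: (hcoord L *m M).
Proof.
move=> uM.
have /choice[F FM] L : exists L', exists c, c != 0 /\
    hcoord L' = c *: (hcoord L *m M).
  apply: exists_point; apply: contraTneq (hcoord_neq0 L) => LM.
  by rewrite -(mulmxK uM (hcoord L)) LM mul0mx eqxx.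
have pF d f L : f \is d.-homog ->
    exists2 c, c != 0 & peval f (F L) = c * peval (f \mPo mx_form M) L.
  move=> fd; have [c [cn Lc]] := FM L; exists (c ^+ d); first by rewrite expf_neq0.
  by rewrite !pevalE mx_formE Lc (meval_dhomog _ _ fd).
have cF : continuous (F : proj_space K n -> proj_space K n).
  apply/continuousP => _ [S Sh ->].
  exists [set f \mPo mx_form M | f in S].
    move=> _ [f /Sh[d fd] <-]; exists d; exact: comp_mx_form_dhomog.
  rewrite -preimage_setC; congr (~` _); apply/seteqP; split=> L /=.
    move=> FL _ [f Sf <-]; have [d fd] := Sh _ Sf.
    have [c cn] := pF d f L fd; rewrite FL // => /esym/eqP.
    by rewrite mulf_eq0 (negPf cn) => /eqP.
  move=> FL f Sf; have [d fd] := Sh _ Sf.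
  by have [c cn ->] := pF d f L fd; rewrite FL ?mulr0 //; exists f.
exists F; split=> //; split=> // L u [d [P [Q [Pd Qd QL uPQ]]]].
exists d, (P \mPo mx_form M), (Q \mPo mx_form M); split.
- exact: comp_mx_form_dhomog.
- exact: comp_mx_form_dhomog.
- have [c cn] := pF d Q L Qd; apply: contra_eq_neq => /= ->.
  by rewrite mulr0.
have {}uPQ : \forall L' \near L, u (F L') = peval P (F L') / peval Q (F L').
  by exact: cF uPQ.
apply: filterS uPQ => L' /= ->.
have [c [cn Lc]] := FM L'.
(* Numerator and denominator have the same degree, so the unknown factor [c] cancels. *)
rewrite !pevalE !mx_formE Lc !(meval_dhomog _ _ Pd) !(meval_dhomog _ _ Qd).
by rewrite -mulf_div divff ?mul1r // expf_neq0.
Qed.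

End Projective.

(** * Linear isometries acting on the quadric threefold *)

Section QuadricIsometries.
Variable K : closedFieldType.
Implicit Types (v w : 'rV[K]_5) (M : 'M[K]_5).

Definition quad v : K := v 0 (inord 0) ^+ 2 +
  (v 0 (inord 1) * v 0 (inord 2) - v 0 (inord 3) * v 0 (inord 4)).

Lemma quadric_formE v : (@quadric_form K).@[v 0] = quad v.
Proof.
by rewrite /quadric_form mevalB mevalD rmorphXn /= !mevalM !mevalXU /quad addrA.
Qed.

Lemma sum5E (F : 'I_5 -> K) : \sum_i F i =
  F (inord 0) + (F (inord 1) + (F (inord 2) + (F (inord 3) + F (inord 4)))).
Proof.
rewrite !big_ord_recl big_ord0 addr0.
by do ![congr (_ + _)|congr F; apply: val_inj; rewrite /= ?inordK].
Qed.

Lemma row5P v w : (forall k, (k < 5)%N -> v 0 (inord k) = w 0 (inord k)) ->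
  v = w.
Proof. by move=> h; apply/rowP => i; rewrite -(inord_val i) h. Qed.

Definition isometry M : Prop :=
  (forall v, quad (v *m M) = quad v) /\
  (forall v, (v *m M) 0 (inord 0) = v 0 (inord 0)).

Lemma inord5_eq i j : (i < 5)%N -> (j < 5)%N ->
  (inord i == inord j :> 'I_5) = (i == j).
Proof. by move=> i5 j5; rewrite -val_eqE /= !inordK. Qed.

(** Adding a kernel vector does not change [quad], so its polar form against each basis vector
    vanishes; this kills the coordinates [x, y, z, w]. The coordinate [u], invisible to the polar
    form in characteristic 2, is fixed by [M]. *)
Lemma isometry_unit M : isometry M -> M \in unitmx.
Proof.
move=> [qM uM]; rewrite -row_free_unit; apply: inj_row_free => v vM.
have v0 : v 0 (inord 0) = 0 by rewrite -uM vM mxE.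
have vD w : quad (v + w) = quad w by rewrite -qM mulmxDl vM add0r qM.
have qv : quad v = 0 by rewrite -qM vM /quad !mxE; ring.
have coord k : quad (v + delta_mx 0 (inord k)) - quad (delta_mx 0 (inord k)) -
    quad v = 0 by rewrite vD qv; ring.
apply: row5P => -[|[|[|[|[|//]]]]] _; rewrite [RHS]mxE //.
- rewrite -[RHS](coord 2) /quad !mxE !inord5_eq //=; ring.
- rewrite -[RHS](coord 1) /quad !mxE !inord5_eq //=; ring.
- rewrite -[RHS]oppr0 -(coord 4) /quad !mxE !inord5_eq //=; ring.
- rewrite -[RHS]oppr0 -(coord 3) /quad !mxE !inord5_eq //=; ring.
Qed.

Lemma isometry_inv M : isometry M -> isometry (invmx M).
Proof.
move=> iM; have uM := isometry_unit iM; have [qM fM] := iM.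
by split=> v; rewrite -{2}(mulmxKV uM v) ?qM ?fM.
Qed.

Lemma isometry_extension M : isometry M ->
  exists F : quadric_threefold K -> quadric_threefold K, is_isomorphism F /\
  forall y, exists c, c != 0 /\ hcoord (val (F y)) = c *: (hcoord (val y) *m M).
Proof.
have lift N : isometry N ->
    exists F : quadric_threefold K -> quadric_threefold K,
      is_morphism F /\ forall y, exists c, c != 0 /\ hcoord (val (F y)) = c *: (hcoord (val y) *m N).
  move=> iN; have uN := isometry_unit iN; have [qN _] := iN.
  have [F [mF FN]] := mx_projective uN.
  have FQ (y : quadric_threefold K) : F (val y) \in (pzeros [set quadric_form]).
    apply/mem_set => _ ->; have [c [cn e]] := FN (val y).
    have qdh : @quadric_form K \is 2.-homog.
      by rewrite rpredB ?rpredD // -?[2%N]/(1 + 1)%N ?expr2 dhomogM //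
        dhomogX /= mdeg1.
    rewrite pevalE e (meval_dhomog _ _ qdh) quadric_formE qN -quadric_formE.
    have /set_mem/(_ _ erefl) := valP y; rewrite pevalE => ->.
    by rewrite mulr0.
  exists (fun y => exist _ (F (val y)) (FQ y)); split=> [|y]; last exact: FN.
  exact: is_morphism_sub mF _.
move=> iM; have uM := isometry_unit iM.
have [F [mF FM]] := lift _ iM; have [G [mG GM]] := lift _ (isometry_inv iM).
exists F; split=> //; split=> //; exists G; split=> // y.
  have [c [cn e]] := GM (F y); have [c' [cn' e']] := FM y.
  apply/val_inj/(hcoord_inj (c := c * c')); first by rewrite mulf_neq0.
  by rewrite e e' -!scalemxAl mulmxK // scalerA.
have [c [cn e]] := FM (G y); have [c' [cn' e']] := GM y.
apply/val_inj/(hcoord_inj (c := c * c')); first by rewrite mulf_neq0.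
by rewrite e e' -!scalemxAl mulmxKV // scalerA.
Qed.

End QuadricIsometries.

(** * The quadric surface *)

Lemma near_val (K : closedFieldType) (X : fspace K) (A : set X)
    (x : subspace_of A) (P : X -> Prop) :
  (\forall y \near val x, P y) -> \forall y \near x, P (val y).
Proof. exact: initial_continuous. Qed.

Section QuadricSurface.
Variable K : closedFieldType.
Local Notation S := (K * K)%type.
Local Notation D := (subspace_of (quadric_section K)).
Implicit Types (a c v : S) (t : D).

Definition scoord t : 'rV[K]_5 := hcoord (val (val t)).

Lemma scoord_inj t t' k : k != 0 -> scoord t = k *: scoord t' -> t = t'.
Proof. by move=> kn /(hcoord_inj kn) e; do 2!apply: val_inj. Qed.

(** For the rank one matrix [N] with entries [a_i c_j], these are [[0 : N11 : N22 : N12 : N21]], so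
    that [det N] is [x y - z w]. *)
Definition segre a c : 'rV[K]_5 :=
  \row_i [:: 0; a.1 * c.1; a.2 * c.2; a.1 * c.2; a.2 * c.1]`_i.

Lemma segreE a c k : (k < 5)%N ->
  segre a c 0 (inord k) = [:: 0; a.1 * c.1; a.2 * c.2; a.1 * c.2; a.2 * c.1]`_k.
Proof. by move=> k5; rewrite mxE inordK. Qed.

Lemma segre_point a c : a != 0 -> c != 0 ->
  exists t k, k != 0 /\ scoord t = k *: segre a c.
Proof.
move=> an cn.
have sn : segre a c != 0.
  have E k : (k < 5)%N -> segre a c = 0 -> _ := fun k5 e =>
    etrans (esym (segreE a c k5)) (congr1 (fun x : 'rV_5 => x 0 (inord k)) e).
  apply/eqP => e; move: (E 1%N isT e) (E 2%N isT e) (E 3%N isT e) (E 4%N isT e).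
  rewrite !mxE /= => /eqP + /eqP + /eqP + /eqP.
  move: an cn; rewrite !pair_neq0 !mulf_eq0.
  by case: (a.1 == 0); case: (a.2 == 0); case: (c.1 == 0); case: (c.2 == 0).
have [L [k [kn Lk]]] := exists_point sn.
have LQ : L \in pzeros [set quadric_form].
  apply/mem_set => _ ->; rewrite pevalE quadric_formE Lk /quad !mxE !inordK //=.
  by ring.
have LS : exist _ L LQ \in quadric_section K.
  by apply/mem_set; rewrite /quadric_section /= pevalE mevalXU Lk !mxE
    inordK //= mulr0.
by exists (exist _ (exist _ L LQ) LS), k.
Qed.

Lemma scoordP t : scoord t 0 (inord 0) = 0 /\
  scoord t 0 (inord 1) * scoord t 0 (inord 2) =
  scoord t 0 (inord 3) * scoord t 0 (inord 4).
Proof.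
have t0 : scoord t 0 (inord 0) = 0.
  by have /set_mem := valP t; rewrite /quadric_section /= pevalE mevalXU.
split=> //; apply/eqP; rewrite -subr_eq0; apply/eqP.
have /set_mem/(_ _ erefl) := valP (val t).
by rewrite pevalE quadric_formE /quad -/(scoord t) t0 expr0n add0r.
Qed.

Lemma point_segre t : exists ac : S * S, [/\ ac.1 != 0, ac.2 != 0 &
  exists k, k != 0 /\ scoord t = k *: segre ac.1 ac.2].
Proof.
have [t0 tq] := scoordP t.
have tn : scoord t != 0 := hcoord_neq0 _.
pose x k := scoord t 0 (inord k).
have build k a c : k != 0 ->
    (forall i, (i < 5)%N -> x i =
      k * [:: 0; a.1 * c.1; a.2 * c.2; a.1 * c.2; a.2 * c.1]`_i) ->
    exists ac : S * S, [/\ ac.1 != 0, ac.2 != 0 &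
      exists k, k != 0 /\ scoord t = k *: segre ac.1 ac.2].
  move=> kn h.
  have e : scoord t = k *: segre a c.
    by apply: row5P => i i5; rewrite mxE segreE // -h.
  exists (a, c); split; last by exists k.
    apply: contraNneq tn => /= a0; rewrite e a0; apply/eqP/row5P => i i5.
    by rewrite !mxE inordK //; move: i i5 => [|[|[|[|[|//]]]]] _ /=; ring.
  apply: contraNneq tn => /= c0; rewrite e c0; apply/eqP/row5P => i i5.
  by rewrite !mxE inordK //; move: i i5 => [|[|[|[|[|//]]]]] _ /=; ring.
have tq' : x 1 * x 2 = x 3 * x 4 := tq; have t0' : x 0 = 0 := t0.
(* A rank one matrix is the product of the column and the row through a nonzero entry, divided by
   that entry. *)
have [x1|x1] := eqVneq (x 1) 0; last first.
  apply: (build (x 1)^-1 (x 1, x 4) (x 1, x 3)); first by rewrite invr_eq0.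
  move=> [|[|[|[|[|//]]]]] _ /=; rewrite ?t0'; try by field.
  by rewrite [x 4 * _]mulrC -tq'; field.
have [x3|x3] := eqVneq (x 3) 0; last first.
  apply: (build (x 3)^-1 (x 3, x 2) (x 1, x 3)); first by rewrite invr_eq0.
  move=> [|[|[|[|[|//]]]]] _ /=; rewrite ?t0'; try by field.
  by rewrite [x 2 * _]mulrC tq'; field.
have [x4|x4] := eqVneq (x 4) 0; last first.
  apply: (build (x 4)^-1 (x 1, x 4) (x 4, x 2)); first by rewrite invr_eq0.
  move=> [|[|[|[|[|//]]]]] _ /=; rewrite ?t0'; try by field.
  by rewrite tq'; field.
apply: (build (x 2) (0, 1) (0, 1)).
  apply: contraNneq tn => x2; apply/eqP/row5P => i i5; rewrite [RHS]mxE.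
  by move: i i5 => [|[|[|[|[|//]]]]] _.
by move=> [|[|[|[|[|//]]]]] _ /=; rewrite ?t0' ?x1 ?x3 ?x4; ring.
Qed.

Lemma segre_par k a c a' c' : k != 0 -> a != 0 -> c != 0 ->
  segre a' c' = k *: segre a c -> par a a' /\ par c c'.
Proof.
move=> kn an cn e.
have E i (i5 : (i < 5)%N) :
    [:: 0; a'.1 * c'.1; a'.2 * c'.2; a'.1 * c'.2; a'.2 * c'.1]`_i =
    k * [:: 0; a.1 * c.1; a.2 * c.2; a.1 * c.2; a.2 * c.1]`_i.
  by rewrite -!segreE // e mxE.
have := (E 1%N isT, E 2%N isT, E 3%N isT, E 4%N isT).
move=> [[[E1 E2] E3] E4]; rewrite /= in E1 E2 E3 E4.
(* Two proportional columns (or rows) of the matrices, for a nonzero coordinate [x] of the other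
   factor, compare [b] with [b']. *)
have aux (b b' : S) x x' : b != 0 -> x != 0 ->
    b'.1 * x' = k * (b.1 * x) -> b'.2 * x' = k * (b.2 * x) -> par b b'.
  move=> bn xn h1 h2; have x'n : x' != 0.
    apply: contraTneq bn => x'0; move/eqP: h1; move/eqP: h2.
    rewrite x'0 !mulr0 ![0 == _]eq_sym !mulf_eq0 (negPf kn) (negPf xn).
    rewrite !orbF !orFb.
    by rewrite pair_neq0 negb_or !negbK => -> ->.
  apply: (mulIf x'n); rewrite -!mulrA h1 h2; ring.
split.
  move: cn; rewrite pair_neq0 => /orP[xn|xn].
    exact: aux xn E1 E4.
  exact: aux xn E3 E2.
move: an; rewrite pair_neq0 => /orP[xn|xn].
  by apply: (aux _ _ a.1 a'.1) => //; rewrite ![_ * a.1]mulrC [_ * a'.1]mulrC.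
by apply: (aux _ _ a.2 a'.2) => //; rewrite ![_ * a.2]mulrC [_ * a'.2]mulrC.
Qed.

Lemma segre_scale k k' a c : segre (k * a.1, k * a.2) (k' * c.1, k' * c.2) =
  (k * k') *: segre a c.
Proof.
by apply: row5P => -[|[|[|[|[|//]]]]] _; rewrite !mxE inordK //=; ring.
Qed.

(** Together with [ruling2], the inverse of the Segre parametrization by chosen representatives,
    meaningful only up to [par]. *)
Definition ruling1 t : S := (projT1 (cid (point_segre t))).1.
Definition ruling2 t : S := (projT1 (cid (point_segre t))).2.

Lemma rulingP t : [/\ ruling1 t != 0, ruling2 t != 0 &
  exists k, k != 0 /\ scoord t = k *: segre (ruling1 t) (ruling2 t)].
Proof. exact: projT2 (cid (point_segre t)). Qed.

(** When [a] or [c] is zero, the value is an arbitrary point that makes the function total. *)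
Definition of_segre a c : D :=
  if pselect (a != 0 /\ c != 0) is left h then
    projT1 (cid (segre_point (proj1 h) (proj2 h)))
  else projT1 (cid (segre_point (e1_neq0 K) (e1_neq0 K))).

Lemma scoord_of_segre a c : a != 0 -> c != 0 ->
  exists k, k != 0 /\ scoord (of_segre a c) = k *: segre a c.
Proof.
by rewrite /of_segre => an cn; case: pselect => [h|[]//]; case: cid.
Qed.

Lemma ruling_of_segre a c : a != 0 -> c != 0 ->
  par (ruling1 (of_segre a c)) a /\ par (ruling2 (of_segre a c)) c.
Proof.
move=> an cn; have [k [kn e]] := scoord_of_segre an cn.
have [r1 r2 [k' [kn' e']]] := rulingP (of_segre a c).
suff [] : par a (ruling1 (of_segre a c)) /\ par c (ruling2 (of_segre a c)).
  by move=> /par_sym ? /par_sym.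
apply: (@segre_par (k'^-1 * k)) => //; first by rewrite mulf_neq0 ?invr_eq0.
by rewrite -scalerA -e e' scalerK.
Qed.

Lemma ruling_inj t t' : par (ruling1 t) (ruling1 t') ->
  par (ruling2 t) (ruling2 t') -> t = t'.
Proof.
have [n1 n2 [k [kn e]]] := rulingP t; have [n1' n2' [k' [kn' e']]] := rulingP t'.
move=> /(par_scale n1 n1')[l ln el] /(par_scale n2 n2')[m mn em].
have knz : k' * (l * m) != 0 by rewrite !mulf_neq0.
apply/esym/(scoord_inj (k := (k' * (l * m)) * k^-1)).
  by rewrite mulf_neq0 ?invr_eq0.
by rewrite e' el em segre_scale e !scalerA divfK.
Qed.

(** Nonvanishing loci of single forms are a basis of the Zariski topology of [P^4], and [D] carries
    the topology induced from it in two steps. *)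
Lemma quadric_section_nbhs t0 (U : set D) : nbhs t0 U ->
  exists e (G : {mpoly K[5]}), [/\ G \is e.-homog, G.@[scoord t0 0] != 0 &
    forall t, G.@[scoord t 0] != 0 -> U t].
Proof.
rewrite nbhsE => -[_ [[_ [_ [T Th ->] <-] <-] Ut0] UU].
move: Ut0 => /= /existsNP[G /not_implyP[TG /eqP Gt0]].
have [e Ge] := Th _ TG; exists e, G; split=> // t Gt; apply: UU => /= /(_ _ TG).
exact: (elimN eqP Gt).
Qed.

Lemma near_surface t (P : proj_space K 4 -> Prop) :
  (\forall L \near val (val t), P L) -> \forall t' \near t, P (val (val t')).
Proof.
move=> /(@near_val _ (proj_space K 4) _ (val t)).
exact: (@near_val _ (quadric_threefold K) _ t (fun y => P (val y))).
Qed.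

(** The ratio of two coordinates is regular where the denominator is nonzero. Its pullback by [g] is
    thus locally [P / Q] with forms of equal degree, and [G] cuts out a neighbourhood on which this
    holds. *)
Lemma morphism_ratio (g : D -> D) t0 (i j : 'I_5) : is_morphism g ->
  scoord (g t0) 0 i != 0 ->
  exists d (P Q : {mpoly K[5]}) e (G : {mpoly K[5]}),
    [/\ P \is d.-homog, Q \is d.-homog, G \is e.-homog, G.@[scoord t0 0] != 0 &
    forall t, G.@[scoord t 0] != 0 ->
      [/\ Q.@[scoord t 0] != 0, scoord (g t) 0 i != 0 &
       scoord (g t) 0 j * Q.@[scoord t 0] = scoord (g t) 0 i * P.@[scoord t 0]]].
Proof.
move=> [cg rg] gi.
pose ratio (L : proj_space K 4) := peval 'X_j L / peval 'X_i L.
pose ratio' (y : quadric_threefold K) := ratio (val y).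
pose ratio'' (t : D) := ratio' (val t).
have X1 k : ('X_k : {mpoly K[5]}) \is 1.-homog by rewrite dhomogX /= mdeg1.
have r0 : regular_at (val (val (g t0)) : proj_space K 4) ratio.
  exists 1%N, 'X_j, 'X_i; split=> //; first by rewrite pevalE mevalXU.
  exact: (@filterE _ (nbhs (val (val (g t0)) : proj_space K 4))) _.
have r1 : regular_at (val (g t0) : quadric_threefold K) ratio'.
  by exists ratio => //; exact: filterE.
have r2 : regular_at (g t0) ratio'' by exists ratio' => //; exact: filterE.
(* Regularity on a nested subspace unfolds into an extension [u1] to the threefold, then [u2] to
   [P^4], then a quotient of forms. *)
have [u1 [u2 [d [P [Q [Pd Qd Qn h2]]]] h1] h0] := rg _ _ r2.
have {}h1 : \forall t \near t0, u1 (val t) = u2 (val (val t))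
  by exact: (@near_val _ (quadric_threefold K) _ t0
    (fun y => u1 y = u2 (val y)) h1).
have {}h2 : \forall t \near t0, u2 (val (val t)) =
    peval P (val (val t)) / peval Q (val (val t))
  by exact: (near_surface (P := fun L => u2 L = peval P L / peval Q L) h2).
have near_neq0 t (G : {mpoly K[5]}) e : G \is e.-homog -> G.@[scoord t 0] != 0 ->
    \forall t' \near t, G.@[scoord t' 0] != 0.
  move=> Ge Gt; apply: (near_surface (P := fun L => peval G L != 0)).
  by apply: open_nbhs_nbhs; split=> //; apply: peval_neq0_open; exists e.
have nQ := near_neq0 t0 Q d Qd Qn.
have ngi : \forall t \near t0, scoord (g t) 0 i != 0.
  have gi' : ('X_i : {mpoly K[5]}).@[scoord (g t0) 0] != 0 by rewrite mevalXU.
  have o : \forall t \near t0, ('X_i : {mpoly K[5]}).@[scoord (g t) 0] != 0.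
    by exact: cg (near_neq0 _ _ _ (X1 i) gi').
  by apply: filterS o => t; rewrite mevalXU.
have [] := @quadric_section_nbhs t0 (fun t => [/\ Q.@[scoord t 0] != 0,
    scoord (g t) 0 i != 0 & scoord (g t) 0 j * Q.@[scoord t 0] =
    scoord (g t) 0 i * P.@[scoord t 0]]).
  near=> t.
  have Qt : Q.@[scoord t 0] != 0 by near: t.
  have gt : scoord (g t) 0 i != 0 by near: t.
  split=> //.
  have e0 : ratio'' (g t) = u1 (val t) by near: t.
  have e1 : u1 (val t) = u2 (val (val t)) by near: t.
  have e2 : u2 (val (val t)) = peval P (val (val t)) / peval Q (val (val t)).
    by near: t.
  move: e0; rewrite e1 e2 /ratio'' /ratio' /ratio !pevalE !mevalXU.
  by move/eqP; rewrite eqr_div // => /eqP ->; rewrite mulrC.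
move=> e [G [Ge Gt0 GU]]; exists d, P, Q, e, G; split=> //.
Unshelve. all: by end_near.
Qed.

End QuadricSurface.

(** * Automorphisms of the quadric surface and their extension *)

Section SurfaceAutomorphisms.
Variable K : closedFieldType.
Local Notation S := (K * K)%type.
Local Notation D := (subspace_of (quadric_section K)).
Implicit Types (a c v : S) (t : D).

Lemma isform_meval d n (F : {mpoly K[n]}) (P : S -> 'rV[K]_n) :
  F \is d.-homog -> (forall i, isform 1 (fun v => P v 0 i)) ->
  isform d (fun v => F.@[P v 0]).
Proof.
move=> Fd hP.
apply: (@isform_ext _ _ (fun v =>
    \sum_(m <- msupp F | m \in msupp F) F@_m * \prod_i P v 0 i ^+ m i)).
  by move=> v; rewrite mevalE [RHS]big_seq.
apply: isform_sum => m mF; apply: isformZ.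
have dE : d = mdeg m := esym (dhomog_mf Fd mF); rewrite dE mdegE.
apply: (@isform_prod _ _ m _ (fun i v => P v 0 i ^+ m i)) => i.
by rewrite -[X in isform X]mul1n; exact: isformX.
Qed.

Section Curves.
Variables (g : D -> D) (psi : S -> D) (Psi : S -> 'rV[K]_5).
Hypothesis mg : is_morphism g.
Hypothesis Psi_linear : forall i, isform 1 (fun v => Psi v 0 i).
Hypothesis psiE : forall v, v != 0 ->
  exists k, k != 0 /\ scoord (psi v) = k *: Psi v.

Let meval_psi d (F : {mpoly K[5]}) v : v != 0 -> F \is d.-homog ->
  exists2 k, k != 0 & F.@[scoord (psi v) 0] = k * F.@[Psi v 0].
Proof.
move=> /psiE[k [kn ->]] Fd; exists (k ^+ d); first by rewrite expf_neq0.
exact: meval_dhomog.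
Qed.

(** Along a line, parametrized by the linear forms [Psi], the forms of [morphism_ratio] restrict to
    binary forms of the same degrees. *)
Let local_ratio (i0 i1 : 'I_5) v0 : v0 != 0 -> scoord (g (psi v0)) 0 i0 != 0 ->
  exists d P Q e G, [/\ isform d P /\ isform d Q, isform e G, Q v0 != 0,
    G v0 != 0 & forall v, v != 0 -> G v != 0 ->
      [/\ Q v != 0, scoord (g (psi v)) 0 i0 != 0 &
       scoord (g (psi v)) 0 i1 * Q v = scoord (g (psi v)) 0 i0 * P v]].
Proof.
move=> vn0 si; have [d [P [Q [e [G [Pd Qd Ge Gt0 hG]]]]]] := morphism_ratio i1 mg si.
have GG v : v != 0 -> G.@[Psi v 0] != 0 -> G.@[scoord (psi v) 0] != 0.
  by move=> vn; have [k kn ->] := meval_psi vn Ge; exact: mulf_neq0.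
have G0 : G.@[Psi v0 0] != 0.
  apply: contraNneq Gt0; have [k kn ->] := meval_psi vn0 Ge => ->.
  by rewrite mulr0.
have main v : v != 0 -> G.@[Psi v 0] != 0 ->
      [/\ Q.@[Psi v 0] != 0, scoord (g (psi v)) 0 i0 != 0 &
       scoord (g (psi v)) 0 i1 * Q.@[Psi v 0] =
       scoord (g (psi v)) 0 i0 * P.@[Psi v 0]].
  move=> vn /(GG v vn) /hG[]; have [k [kn ->]] := psiE vn.
  rewrite (meval_dhomog _ _ Pd) (meval_dhomog _ _ Qd) => Qn sn e'.
  split=> //; first by apply: contraNneq Qn => ->; rewrite mulr0.
  apply: (@mulfI _ (k ^+ d)); first by rewrite expf_neq0.
  by rewrite mulrCA e'; ring.
exists d, (fun v => P.@[Psi v 0]), (fun v => Q.@[Psi v 0]), e.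
exists (fun v => G.@[Psi v 0]).
split=> //; first by split; exact: isform_meval.
- exact: isform_meval.
- by have [] := main v0 vn0 G0.
Qed.

(** The relation says that [r] is the ratio of coordinates [i0] and [i1]. The pair may change with
    the point, since [ratmap_of_local] patches local representations. *)
Let rational_of_coordinates (r : D -> S) :
  (forall t, r t != 0) ->
  (forall t, exists i0 i1 : 'I_5,
    [/\ (scoord t 0 i0 != 0) || (scoord t 0 i1 != 0) &
      forall t', scoord t' 0 i0 * (r t').2 = scoord t' 0 i1 * (r t').1]) ->
  rational (fun v => r (g (psi v))).
Proof.
move=> rn hr; apply: ratmap_of_local => [v _|v0 vn0]; first exact: rn.
have [i0 [i1 [/orP[si|si] rel]]] := hr (g (psi v0)).
  have [d [P [Q [e [G [[hP hQ] hG Qn Gn h]]]]]] := local_ratio i1 vn0 si.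
  exists d, (fun v => (Q v, P v)), e, G; split=> //.
    by rewrite pair_neq0 Qn.
  move=> v vn /(h v vn)[_ sn e']; rewrite /par /=.
  by apply: (mulfI sn); rewrite mulrCA -e' [in RHS]mulrA rel; ring.
have [d [P [Q [e [G [[hP hQ] hG Qn Gn h]]]]]] := local_ratio i0 vn0 si.
exists d, (fun v => (P v, Q v)), e, G; split=> //.
  by rewrite pair_neq0 Qn orbT.
move=> v vn /(h v vn)[_ sn e']; rewrite /par /=.
by apply: (mulfI sn); rewrite mulrA -rel mulrAC e'; ring.
Qed.

Lemma curve_rational : rational (fun v => ruling1 (g (psi v))) /\
  rational (fun v => ruling2 (g (psi v))).
Proof.
have nz t : exists2 k, (k < 5)%N & scoord t 0 (inord k) != 0.
  apply: contrapT => /forall2NP h; have /eqP[] := hcoord_neq0 (val (val t)).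
  apply: row5P => k k5; rewrite [RHS]mxE.
  by have [//|/negP] := h k; rewrite negbK => /eqP.
have [s0 _] := all_and2 (@scoordP K).
split; apply: rational_of_coordinates => t; try by have [] := rulingP t.
  (* The first factor is [x : w], which equals [z : y]; the pair containing a nonzero coordinate is
     taken. *)
  have [[|[|[|[|[|//]]]]] _ hk] := nz t; first by rewrite s0 eqxx in hk.
  - exists (inord 1), (inord 4); rewrite hk; split=> // t'.
    have [_ _ [k [_ ->]]] := rulingP t'.
    by rewrite !mxE !inordK //=; ring.
  - exists (inord 3), (inord 2); rewrite hk orbT; split=> // t'.
    have [_ _ [k [_ ->]]] := rulingP t'.
    by rewrite !mxE !inordK //=; ring.
  - exists (inord 3), (inord 2); rewrite hk; split=> // t'.
    have [_ _ [k [_ ->]]] := rulingP t'.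
    by rewrite !mxE !inordK //=; ring.
  - exists (inord 1), (inord 4); rewrite hk orbT; split=> // t'.
    have [_ _ [k [_ ->]]] := rulingP t'.
    by rewrite !mxE !inordK //=; ring.
(* The second factor is [x : z], which equals [w : y]. *)
have [[|[|[|[|[|//]]]]] _ hk] := nz t; first by rewrite s0 eqxx in hk.
- exists (inord 1), (inord 3); rewrite hk; split=> // t'.
  have [_ _ [k [_ ->]]] := rulingP t'.
  by rewrite !mxE !inordK //=; ring.
- exists (inord 4), (inord 2); rewrite hk orbT; split=> // t'.
  have [_ _ [k [_ ->]]] := rulingP t'.
  by rewrite !mxE !inordK //=; ring.
- exists (inord 1), (inord 3); rewrite hk orbT; split=> // t'.
  have [_ _ [k [_ ->]]] := rulingP t'.
  by rewrite !mxE !inordK //=; ring.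
- exists (inord 4), (inord 2); rewrite hk; split=> // t'.
  have [_ _ [k [_ ->]]] := rulingP t'.
  by rewrite !mxE !inordK //=; ring.
Qed.

End Curves.

Lemma of_segreK t : of_segre (ruling1 t) (ruling2 t) = t.
Proof.
have [n1 n2 _] := rulingP t; have [p1 p2] := ruling_of_segre n1 n2.
exact: ruling_inj.
Qed.

Lemma segre_linear1 a i : isform 1 (fun c => segre a c 0 i).
Proof.
apply: (@isform_ext _ _ (fun c =>
  [:: 0; a.1 * c.1; a.2 * c.2; a.1 * c.2; a.2 * c.1]`_i)).
  by move=> c; rewrite mxE.
by case: i => [[|[|[|[|[|//]]]]] _] /=; first exact: isform0;
  apply: isformZ; [exact: isform_fst|exact: isform_snd|exact: isform_snd
    |exact: isform_fst].
Qed.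

Lemma segre_linear2 c i : isform 1 (fun a => segre a c 0 i).
Proof.
apply: (@isform_ext _ _ (fun a =>
  [:: 0; c.1 * a.1; c.2 * a.2; c.2 * a.1; c.1 * a.2]`_i)).
  by move=> a; rewrite mxE; case: i => [[|[|[|[|[|//]]]]] _] //=; rewrite mulrC.
by case: i => [[|[|[|[|[|//]]]]] _] /=; first exact: isform0;
  apply: isformZ; [exact: isform_fst|exact: isform_snd|exact: isform_fst
    |exact: isform_snd].
Qed.

Lemma surface_aut_P1P1 (g g' : D -> D) : is_morphism g -> cancel g g' ->
  cancel g' g -> aut_P1P1 (fun a v => ruling1 (g (of_segre a v)))
                          (fun a v => ruling2 (g (of_segre a v))).
Proof.
move=> mg gg' g'g; split.
- by move=> a v _ _; have [] := rulingP (g (of_segre a v)).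
- move=> a v a' v' an vn an' vn' p1 p2.
  have /(can_inj gg') e := ruling_inj p1 p2.
  have [q1 q2] := ruling_of_segre an vn; have [q1' q2'] := ruling_of_segre an' vn'.
  have [n1 n2 _] := rulingP (of_segre a v); rewrite -e in q1' q2'.
  by split; [exact: par_trans n1 (par_sym q1) q1'
    |exact: par_trans n2 (par_sym q2) q2'].
- move=> b w bn wn; pose t := g' (of_segre b w); have [n1 n2 _] := rulingP t.
  exists (ruling1 t), (ruling2 t); rewrite of_segreK /t g'g.
  by have [] := ruling_of_segre bn wn.
- move=> a an; apply: (curve_rational mg (segre_linear1 a)) => v vn.
  exact: scoord_of_segre.
- move=> v vn; apply: (@curve_rational g (fun a => of_segre a v)
    (fun a => segre a v) mg (segre_linear2 v)) => a an.
  exact: scoord_of_segre.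
Qed.

Lemma ratmap1E (F : S -> S) : ratmap 1 F -> exists al be ga de : K,
  al * de - be * ga != 0 /\
  forall v, F v = (al * v.1 + be * v.2, ga * v.1 + de * v.2).
Proof.
move=> [/isform1E[al [be E1]] /isform1E[ga [de E2]] Fn].
have E v : F v = (al * v.1 + be * v.2, ga * v.1 + de * v.2).
  by rewrite [F v]surjective_pairing E1 E2.
exists al, be, ga, de; split=> //; apply/eqP => d0.
have zero v : F v = 0 -> v = 0.
  by move=> Fv; apply/eqP; apply: contraT => /Fn; rewrite Fv eqxx.
(* If the determinant vanishes, the columns of the adjugate lie in the kernel. They are then zero,
   and so is [F], which contradicts [Fn]. *)
have [_ /eqP] : (de, - ga) = 0 :> S.
  by apply: zero; rewrite E; congr (_, _);
    [rewrite -[RHS]d0 /=; ring|rewrite /=; ring].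
rewrite oppr_eq0 => /eqP ga0.
have [_ /eqP] : (be, - al) = 0 :> S.
  by apply: zero; rewrite E; congr (_, _);
    [rewrite /=; ring|rewrite -[RHS]oppr0 -d0 /=; ring].
rewrite oppr_eq0 => /eqP al0.
have := Fn (1, 0) (e1_neq0 K).
by rewrite E ga0 al0 /= !mul0r !mulr0 !addr0 eqxx.
Qed.

Lemma segre_isometry (b : bool) F1 F2 : ratmap 1 F1 -> ratmap 1 F2 ->
  exists M s, [/\ isometry M, s != 0 & forall a c, segre a c *m M =
    s *: (if b then segre (F2 c) (F1 a) else segre (F1 a) (F2 c))].
Proof.
move=> /ratmap1E[p [q [r [t [det1 E1]]]]] /ratmap1E[p' [q' [r' [t' [det2 E2]]]]].
pose dd := (p * t - q * r) * (p' * t' - q' * r').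
have ddn : dd != 0 by rewrite mulf_neq0.
(* The map on matrices multiplies the determinant by [dd] (the transposition does not matter), so
   rescaling by a square root of [dd^-1] preserves it. *)
have [s sE] : exists s : K, s ^+ 2 = dd^-1.
  have [s] := @solve_monicpoly K 2 (fun i => if i is 0%N then dd^-1 else 0) isT.
  by rewrite big_ord_recl big_ord1 /= expr0 mulr1 mul0r addr0; exists s.
have sn : s != 0.
  apply: contraNneq ddn => s0; rewrite -invr_eq0 -sE s0 expr0n //.
pose row a c := s *: (if b then segre (F2 c) (F1 a) else segre (F1 a) (F2 c)).
pose e1 : S := (1, 0); pose e2 : S := (0, 1).
(* The basis vectors for [x, y, z, w] are the Segre images of pairs from [e1, e2]; bilinearity
   extends the formula to all [a] and [c]. *)
pose M : 'M[K]_5 := \matrix_i nth 0 [:: delta_mx 0 (inord 0);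
  row e1 e1; row e2 e2; row e1 e2; row e2 e1] i.
have vM (v : 'rV[K]_5) k : (k < 5)%N -> (v *m M) 0 (inord k) =
    v 0 (inord 0) * (k == 0)%N%:R +
    (v 0 (inord 1) * row e1 e1 0 (inord k) +
    (v 0 (inord 2) * row e2 e2 0 (inord k) +
    (v 0 (inord 3) * row e1 e2 0 (inord k) +
     v 0 (inord 4) * row e2 e1 0 (inord k)))).
  by move=> k5; rewrite mxE sum5E ![M _ _]mxE !inordK //=
    [delta_mx _ _ _ _]mxE eqxx inord5_eq.
exists M, s; split=> //.
  split=> v; last first.
    by rewrite vM // /row; case: (b); rewrite !mxE !inordK //=; ring.
  (* The factor [s ^+ 2 * dd] is 1; inserting it leaves a polynomial identity. *)
  have -> : quad v = v 0 (inord 0) ^+ 2 + s ^+ 2 * dd *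
      (v 0 (inord 1) * v 0 (inord 2) - v 0 (inord 3) * v 0 (inord 4)).
    by rewrite sE mulVf // mul1r.
  rewrite /quad !vM // /row /dd; case: (b);
    rewrite !mxE !inordK //= !E1 !E2 /=; ring.
move=> a c; apply: row5P => k k5; rewrite vM // /row.
case: (b); rewrite !mxE !inordK //= !E1 !E2 /=;
  move: k k5 => [|[|[|[|[|//]]]]] _ /=; ring.
Qed.

Theorem surface_automorphism_extends (g : D -> D) : is_isomorphism g ->
  exists F : quadric_threefold K -> quadric_threefold K,
    is_isomorphism F /\ forall t, F (val t) = val (g t).
Proof.
move=> [mg [g' [mg' gg' g'g]]].
have H := surface_aut_P1P1 mg gg' g'g; have H' := surface_aut_P1P1 mg' g'g gg'.
have [a v an vn|F1 [F2 [F1r F2r hF]]] := aut_P1P1_structure H H'.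
  by rewrite of_segreK gg'; exact: ruling_of_segre.
have [b hb] : exists b : bool, forall a v, a != 0 -> v != 0 ->
    exists k, k != 0 /\ scoord (g (of_segre a v)) =
      k *: (if b then segre (F2 v) (F1 a) else segre (F1 a) (F2 v)).
  (* This turns equality of points in both factors into proportionality of the coordinates in
     [P^4]. *)
  have scale t a c : a != 0 -> c != 0 -> par (ruling1 t) a -> par (ruling2 t) c ->
      exists k, k != 0 /\ scoord t = k *: segre a c.
    move=> an cn p1 p2; have [n1 n2 [k [kn ->]]] := rulingP t.
    have [l ln e1] := par_scale an n1 (par_sym p1).
    have [m mn e2] := par_scale cn n2 (par_sym p2).
    by exists (k * (l * m)); rewrite e1 e2 segre_scale scalerA !mulf_neq0.
  have [_ _ n1] := F1r; have [_ _ n2] := F2r.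
  case: hF => h; [exists false|exists true] => a v an vn;
    have [p1 p2] := h a v an vn; apply: scale => //; by [exact: n1|exact: n2].
have [M [s [iM sn hM]]] := segre_isometry b F1r F2r.
have [F [iF FM]] := isometry_extension iM; exists F; split=> // t.
have [n1 n2 [k [kn et]]] := rulingP t.
have [l [ln]] := hb _ _ n1 n2; rewrite of_segreK => eg.
have [c [cn eF]] := FM (val t).
apply/val_inj/(hcoord_inj (c := c * k * s * l^-1)).
  by rewrite !mulf_neq0 ?invr_eq0.
rewrite eF -/(scoord t) et -scalemxAl hM -/(scoord (g t)) eg !scalerA divfK //.
Qed.

End SurfaceAutomorphisms.

(** With [k] the inverse of [h], the automorphism [h' \o k] of the quadric surface extends to the
    threefold and carries one identification to the other. *)
Theorem gluing_quadric_isomorphic (K : closedFieldType) (X : fspace K)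
    (A : set X) (h h' : subspace_of A -> subspace_of (quadric_section K)) :
  is_isomorphism h -> is_isomorphism h' -> isomorphic (gluing h) (gluing h').
Proof.
move=> /is_isomorphism_inv[k [ik hk _]] ih'.
have [F [iF Fg]] := surface_automorphism_extends (is_isomorphism_comp ik ih').
by apply: (gluing_isomorphic iF) => a; rewrite Fg /= hk.
Qed.

Local Open Scope complex_scope.

Theorem lemma1p3 (R : realType)
  (W : fspace R[i]) (pi : W -> affine_space R[i] 1)
  (W_variety : variety W) (W_smooth : smooth W)
  (pi_morphism : is_morphism pi) (pi_flat : flat_over_line pi)
  (fibres_reduced : forall t, reduced_fibre pi t)
  (fibres_projective :
     forall t, projective_variety (subspace_of (fibre pi t)))
  (fibres_dimension : forall t, has_dimension (subspace_of (fibre pi t)) 3)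
  (fibres_smooth : forall t, t <> line_pt 0 -> smooth (subspace_of (fibre pi t)))
  (Y : fspace R[i]) (iota : Y -> subspace_of (fibre pi (line_pt 0)))
  (iota_isomorphism : is_isomorphism iota)
  (p : Y) (p_conifold : conifold_singularity pi (val (iota p)))
  (Y_smooth : forall y, y <> p -> smooth_at y)
  (* [phi] is the fixed identification of the two copies of [D] *)
  (Y0 : fspace R[i]) (b : Y0 -> Y) (b_blowup : is_blowup p b)
  (phi : subspace_of (b @^-1` [set p]) ->
         subspace_of (quadric_section R[i]))
  (phi_isomorphism : is_isomorphism phi)
  (f f' : subspace_of (b @^-1` [set p]) -> subspace_of (b @^-1` [set p]))
  (f_automorphism : is_isomorphism f) (f'_automorphism : is_isomorphism f') :
  isomorphic (gluing (phi \o f)) (gluing (phi \o f')).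
Proof.
by apply: gluing_quadric_isomorphic; exact: is_isomorphism_comp phi_isomorphism.
Qed.
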